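(* Let $(\mathcal{L}_1,\circ^1_\lambda,\ast^1_\lambda)$ and $(\mathcal{L}_2,\circ^2_\lambda,\ast^2_\lambda)$ be two pre-Lie Poisson conformal superalgebras. Set $\mathcal{L}:=\mathcal{L}_1\otimes_{\mathbb{C}[\partial]}\mathcal{L}_2$, graded by $|a\otimes b|=|a|+|b|$, with $\mathbb{C}[\partial]$-module structure $\partial(a\otimes b):=(\partial a)\otimes b=a\otimes(\partial b)$ for $a\in\mathcal{L}_1$, $b\in\mathcal{L}_2$. Define two $\lambda$-products on $\mathcal{L}$ by $$(a_1\otimes a_2)\circ_\lambda(b_1\otimes b_2)=(-1)^{|a_2||b_1|}(a_1\circ^1_\lambda b_1)\otimes(a_2\circ^2_\lambda b_2),$$ $$(a_1\otimes a_2)\ast_\lambda(b_1\otimes b_2)=(-1)^{|a_2||b_1|}\big((a_1\ast^1_\lambda b_1)\otimes(a_2\circ^2_\lambda b_2)+(a_1\circ^1_\lambda b_1)\otimes(a_2\ast^2_\lambda b_2)\big),$$ for all $a_1,b_1\in\mathcal{L}_1$, $a_2,b_2\in\mathcal{L}_2$. Then $(\mathcal{L},\circ_\lambda,\ast_\lambda)$ is a pre-Lie Poisson conformal superalgebra.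
   Context: All vector spaces and linear maps are over $\mathbb{C}$. A $\mathbb{Z}_2$-graded $\mathbb{C}[\partial]$-module is a $\mathbb{C}[\partial]$-module $A=A_{\bar0}\oplus A_{\bar1}$ with $\partial A_i\subseteq A_i$; $|a|$ denotes the parity of a homogeneous element $a$. Whenever $|a|$ occurs, $a$ is assumed homogeneous, and the formula is extended by linearity. $A[\lambda]$ denotes polynomials in $\lambda$ with coefficients in $A$. In the formulas for $\mathcal{L}$, the tensor of two polynomials in $\lambda$ is their product: $(\sum\lambda^mu_m)\otimes(\sum\lambda^nv_n)=\sum\lambda^{m+n}u_m\otimes v_n$. A conformal superalgebra $(A,\circ_\lambda)$ is a $\mathbb{Z}_2$-graded $\mathbb{C}[\partial]$-module $A$ with a $\mathbb{C}$-bilinear map $A\otimes A\to A[\lambda]$, $a\otimes b\mapsto a\circ_\lambda b$, with $A_i\circ_\lambda A_j\subseteq A_{i+j}[\lambda]$, satisfying sesquilinearity: $(\partial a)\circ_\lambda b=-\lambda\, a\circ_\lambda b$, $a\circ_\lambda(\partial b)=(\partial+\lambda)(a\circ_\lambda b)$. Substitution convention: if $a\circ_\lambda b=\sum_n\lambda^n c_n$, then $a\circ_{-\partial-\lambda}b=\sum_n(-\partial-\lambda)^nc_n$ with $\partial$ acting on the coefficients $c_n$. It is commutative if $a\circ_\lambda b=(-1)^{|a||b|}b\circ_{-\partial-\lambda}a$, and associative if $a\circ_\lambda(b\circ_\mu c)=(a\circ_\lambda b)\circ_{\lambda+\mu}c$, for all $a,b,c$. A left-symmetric conformal superalgebra $(A,\ast_\lambda)$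 is a conformal superalgebra with $(a\ast_\lambda b)\ast_{\lambda+\mu}c-a\ast_\lambda(b\ast_\mu c)=(-1)^{|a||b|}\big((b\ast_\mu a)\ast_{\lambda+\mu}c-b\ast_\mu(a\ast_\lambda c)\big)$. A pre-Lie Poisson conformal superalgebra $(\mathcal{L},\circ_\lambda,\ast_\lambda)$ is a $\mathbb{Z}_2$-graded $\mathbb{C}[\partial]$-module such that $(\mathcal{L},\circ_\lambda)$ is a commutative associative conformal superalgebra, $(\mathcal{L},\ast_\lambda)$ is a left-symmetric conformal superalgebra, and for all $a,b,c$: $(a\circ_\lambda b)\ast_{\lambda+\mu}c=a\circ_\lambda(b\ast_\mu c)$ and $(a\ast_\lambda b)\circ_{\lambda+\mu}c-a\ast_\lambda(b\circ_\mu c)=(-1)^{|a||b|}\big((b\ast_\mu a)\circ_{\lambda+\mu}c-b\ast_\mu(a\circ_\lambda c)\big)$. *)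

(* Defs.v *)
From HB Require Import structures.
From mathcomp Require Import all_boot all_order all_algebra.
From mathcomp Require Import finmap monalg.
From mathcomp Require Import boolp reals complex.

Set Implicit Arguments.
Unset Strict Implicit.
Unset Printing Implicit Defensive.

Import GRing.Theory.

Local Open Scope ring_scope.
Local Open Scope quotient_scope.

(* modpoly V is V[x].  The coefficient of x^n in p is p@_n, and << v *g n >>  *)
(* is v x^n.  If V is an S-module, V[x] is an S[x]-module.                    *)

Lemma msupp_sumD (K : choiceType) (V W : zmodType) (F : K -> V -> W) :
  (forall k, zmod_morphism (F k)) ->
  {morph (fun p : {malg V[K]} => \sum_(k <- msupp p) F k p@_k) :
     p q / p + q >-> p + q}.
Proof.
move=> Fadd p q /=.
have F0 k : F k 0 = 0 by have:= Fadd k 0 0; rewrite !subrr.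
have FD k u v : F k (u + v) = F k u + F k v.
  have FN w : F k (- w) = - F k w by rewrite -[- w]sub0r Fadd F0 sub0r.
  by rewrite -{1}[v]opprK Fadd FN opprK.
pose d := (msupp p `|` msupp q)%fset.
have Fw (r : {malg V[K]}) : (msupp r `<=` d)%fset ->
    \sum_(k <- msupp r) F k r@_k = \sum_(k <- d) F k r@_k.
  move=> le_rd; apply: big_fset_incl => // k _ /mcoeff_outdom ->.
  exact: F0.
rewrite !Fw ?fsubsetUl ?fsubsetUr ?msuppD_le // -big_split /=.
by apply: eq_bigr => k _; rewrite mcoeffD FD.
Qed.

Lemma msupp_sumU (K : choiceType) (V W : zmodType) (F : K -> V -> W) k v :
  F k 0 = 0 ->
  \sum_(l <- msupp (<< v *g k >> : {malg V[K]})) F l (<< v *g k >>)@_l = F k v.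
Proof.
move=> F0; rewrite msuppU; case: eqP => [->|_]; first by rewrite big_seq_fset0 F0.
by rewrite big_seq_fset1 mcoeffUU.
Qed.

Definition modpoly (V : zmodType) := {malg V[nat]}.
HB.instance Definition _ (V : zmodType) := GRing.Zmodule.on (modpoly V).

Definition modpolyC (V : zmodType) (v : V) : modpoly V := << v *g 0%N >>.

Section ModPolyLmodule.
Variables (S : nzRingType) (V : lmodType S).
Implicit Types (f g : {poly S}) (p q : modpoly V).

Definition modpoly_scale f p : modpoly V :=
  \sum_(i < size f) \sum_(n <- msupp p) << f`_i *: p@_n *g (i + n)%N >>.

Lemma modpoly_scaleDr f : {morph modpoly_scale f : p q / p + q}.
Proof.
move=> p q; rewrite /modpoly_scale -big_split /=; apply: eq_bigr => i _.
apply: (@msupp_sumD _ V (modpoly V) (fun n v => << f`_i *: v *g (i + n)%N >>)).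
by move=> n u v; rewrite scalerBr monalgUB.
Qed.

Lemma modpoly_scale0r f : modpoly_scale f 0 = 0.
Proof. by apply: (addrI (modpoly_scale f 0)); rewrite -modpoly_scaleDr !addr0. Qed.

Lemma modpoly_scale_wid N f p : (size f <= N)%N ->
  modpoly_scale f p =
  \sum_(i < N) \sum_(n <- msupp p) << f`_i *: p@_n *g (i + n)%N >>.
Proof.
move=> le_fN; rewrite /modpoly_scale.
rewrite -!(big_mkord predT
  (fun i => \sum_(n <- msupp p) << f`_i *: p@_n *g (i + n)%N >>)).
rewrite (big_cat_nat (leq0n _) le_fN) /= [X in _ = _ + X]big_nat_cond.
rewrite [X in _ = _ + X]big1 ?addr0 //.
move=> i /andP[/andP[le_fi _] _]; apply: big1 => n _.
by rewrite nth_default // scale0r monalgU0.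
Qed.

Lemma modpoly_scaleDl p : {morph modpoly_scale^~ p : f g / f + g}.
Proof.
move=> f g.
rewrite (modpoly_scale_wid _ (size_polyD f g)).
rewrite (modpoly_scale_wid _ (leq_maxl (size f) (size g))).
rewrite (modpoly_scale_wid _ (leq_maxr (size f) (size g))).
rewrite -big_split /=; apply: eq_bigr => i _; rewrite -big_split /=.
by apply: eq_bigr => n _; rewrite coefD scalerDl monalgUD.
Qed.

Lemma modpoly_scale0l p : modpoly_scale 0 p = 0.
Proof. by rewrite /modpoly_scale size_poly0 big_ord0. Qed.

Lemma modpoly_scaleMX c i v n :
  modpoly_scale (c%:P * 'X^i) << v *g n >> = << c *: v *g (i + n)%N >>.
Proof.
have sz : (size (c%:P * 'X^i)%R <= i.+1)%N.
  rewrite mul_polyC; apply: leq_trans (size_scale_leq _ _) _.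
  by rewrite size_polyXn.
rewrite (modpoly_scale_wid _ sz) big_ord_recr /= big1 => [|j _]; last first.
  apply: big1 => k _.
  by rewrite coefCM coefXn (ltn_eqF (ltn_ord j)) mulr0 scale0r monalgU0.
rewrite add0r coefCM coefXn eqxx mulr1.
apply: (@msupp_sumU _ V (modpoly V) (fun k u => << c *: u *g (i + k)%N >>)).
by rewrite scaler0 monalgU0.
Qed.

Lemma modpoly_ind (Q : modpoly V -> Prop) :
  Q 0 -> (forall p q, Q p -> Q q -> Q (p + q)) ->
  (forall v n, Q << v *g n >>) -> forall p, Q p.
Proof.
by move=> Q0 QD QU p; rewrite [p]monalgE; elim/big_rec: _ => // i x _; apply: QD.
Qed.

Lemma modpoly_poly_ind (Q : {poly S} -> Prop) :
  (forall f g, Q f -> Q g -> Q (f + g)) ->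
  (forall c i, Q (c%:P * 'X^i)) -> forall f, Q f.
Proof.
move=> QD QX f; rewrite -[f]coefK poly_def; elim/big_rec: _ => [|i x _ Qx].
  by have:= QX 0 0; rewrite polyC0 mul0r.
by apply: QD => //; rewrite -mul_polyC.
Qed.

Lemma modpoly_scaleA f g p :
  modpoly_scale f (modpoly_scale g p) = modpoly_scale (f * g) p.
Proof.
elim/modpoly_ind: p f g => [|p q IHp IHq|v n] f g.
- by rewrite !modpoly_scale0r.
- by rewrite !modpoly_scaleDr IHp IHq.
elim/modpoly_poly_ind: g f => [g h IHg IHh|d j] f.
  by rewrite modpoly_scaleDl modpoly_scaleDr IHg IHh mulrDr modpoly_scaleDl.
elim/modpoly_poly_ind: f => [f h IHf IHh|c i].
  by rewrite modpoly_scaleDl IHf IHh mulrDl modpoly_scaleDl.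
rewrite !modpoly_scaleMX -mulrA [_ * (d%:P * _)]mulrA -commr_polyXn -mulrA.
by rewrite mulrA -polyCM -exprD modpoly_scaleMX scalerA addnA.
Qed.

Lemma modpoly_scale1 p : modpoly_scale 1 p = p.
Proof.
elim/modpoly_ind: p => [|p q IHp IHq|v n].
- by rewrite modpoly_scale0r.
- by rewrite modpoly_scaleDr IHp IHq.
by have:= modpoly_scaleMX 1 0 v n; rewrite polyC1 expr0 mulr1 scale1r.
Qed.

HB.instance Definition _ := GRing.Zmodule_isLmodule.Build {poly S} (modpoly V)
  modpoly_scaleA modpoly_scale1 modpoly_scaleDr modpoly_scaleDl.

End ModPolyLmodule.

(* p(x): substitution of the scalar x, acting on the module M, for the        *)
(* variable of p, the coefficients of p being mapped to M by iota.            *)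
Definition modpoly_subst (S : nzRingType) (V : zmodType) (M : lmodType S)
    (iota : V -> M) (x : S) (p : modpoly V) : M :=
  \sum_(n <- msupp p) x ^+ n *: iota p@_n.

(* The free module on L1 * L2 modulo the submodule generated by the           *)
(* bilinearity relations.                                                     *)

Section Tensor.
Variables (S : comNzRingType) (L1 L2 : lmodType S).

Local Notation free := {malg S[(L1 * L2)%type]}.

Inductive tensor_rel : free -> Prop :=
| TensorRel0 : tensor_rel 0
| TensorRelP c x y : tensor_rel x -> tensor_rel y -> tensor_rel (c *: x + y)
| TensorRelL c a a' b :
    tensor_rel (<< (c *: a + a', b) >> - (c *: << (a, b) >> + << (a', b) >>))
| TensorRelR c a b b' :
    tensor_rel (<< (a, c *: b + b') >> - (c *: << (a, b) >> + << (a, b') >>)).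

Definition tensor_kernel : {pred free} := fun x => `[< tensor_rel x >].

Fact tensor_kernel_zmod_closed : zmod_closed tensor_kernel.
Proof.
split; first by apply/asboolP; apply: TensorRel0.
move=> x y /asboolP relx /asboolP rely; apply/asboolP.
by rewrite addrC -scaleN1r; apply: TensorRelP.
Qed.
HB.instance Definition _ :=
  GRing.isZmodClosed.Build free tensor_kernel tensor_kernel_zmod_closed.

Definition tensor := Quotient.quot tensor_kernel.
HB.instance Definition _ := GRing.Zmodule.on tensor.

Definition tensor_pi (x : free) : tensor := \pi_(Quotient.quot tensor_kernel) x.

Lemma tensor_piP x y : reflect (tensor_rel (x - y)) (tensor_pi x == tensor_pi y).
Proof. by rewrite /tensor_pi -Quotient.idealrBE; apply: asboolP. Qed.

Lemma tensor_piD : {morph tensor_pi : x y / x + y}.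
Proof. by move=> x y; rewrite /tensor_pi !piE. Qed.

Lemma tensor_repr (u : tensor) : tensor_pi (repr u) = u.
Proof. exact: reprK. Qed.

Definition tensor_scale (c : S) (u : tensor) : tensor := tensor_pi (c *: repr u).

Lemma tensor_piZ c x : tensor_pi (c *: x) = tensor_scale c (tensor_pi x).
Proof.
apply/eqP/tensor_piP; rewrite -scalerBr -[_ *: _]addr0.
apply: TensorRelP (TensorRel0); apply/tensor_piP.
by rewrite tensor_repr.
Qed.

Fact tensor_scaleA c d u :
  tensor_scale c (tensor_scale d u) = tensor_scale (c * d) u.
Proof. by rewrite -[u]tensor_repr -!tensor_piZ scalerA. Qed.

Fact tensor_scale1 : left_id 1 tensor_scale.
Proof. by move=> u; rewrite -[u]tensor_repr -tensor_piZ scale1r. Qed.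

Fact tensor_scaleDr : right_distributive tensor_scale +%R.
Proof.
move=> c u v; rewrite -[u]tensor_repr -[v]tensor_repr -tensor_piD -!tensor_piZ.
by rewrite scalerDr tensor_piD.
Qed.

Fact tensor_scaleDl u : {morph tensor_scale^~ u : c d / c + d}.
Proof.
by move=> c d; rewrite -[u]tensor_repr -!tensor_piZ scalerDl tensor_piD.
Qed.

HB.instance Definition _ := GRing.Zmodule_isLmodule.Build S tensor
  tensor_scaleA tensor_scale1 tensor_scaleDr tensor_scaleDl.

Definition tens (a : L1) (b : L2) : tensor := tensor_pi << (a, b) >>.

Lemma tensPl c a a' b : tens (c *: a + a') b = c *: tens a b + tens a' b.
Proof.
rewrite /tens /GRing.scale /= -tensor_piZ -tensor_piD.
by apply/eqP/tensor_piP; apply: TensorRelL.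
Qed.

Lemma tensPr c a b b' : tens a (c *: b + b') = c *: tens a b + tens a b'.
Proof.
rewrite /tens /GRing.scale /= -tensor_piZ -tensor_piD.
by apply/eqP/tensor_piP; apply: TensorRelR.
Qed.

Lemma tens0l b : tens 0 b = 0.
Proof.
by have:= tensPl (-1) 0 0 b; rewrite scaler0 add0r scaleN1r addNr.
Qed.

Lemma tensZl c a b : tens (c *: a) b = c *: tens a b.
Proof. by rewrite -[c *: a]addr0 tensPl tens0l addr0. Qed.

Lemma tens_span (u : tensor) :
  exists s : seq (L1 * L2), u = \sum_(ab <- s) tens ab.1 ab.2.
Proof.
rewrite -[u]tensor_repr [repr u]monalgE.
elim/big_rec: _ => [|k x _ [s IHs]].
  by exists [::]; rewrite big_nil /tensor_pi piE.
exists (((repr u)@_k *: k.1, k.2) :: s); rewrite big_cons tensor_piD IHs /=.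
rewrite tensZl /tens -surjective_pairing /GRing.scale /= -tensor_piZ.
by congr (tensor_pi _ + _); apply/malgP=> l; rewrite mcoeffZ !mcoeffU mulrnAr mulr1.
Qed.

Lemma tensor_universal (M : lmodType S) (f : L1 -> L2 -> M) :
  (forall b, linear (f^~ b)) -> (forall a, linear (f a)) ->
  exists! F : tensor -> M, linear F /\ forall a b, F (tens a b) = f a b.
Proof.
move=> flin1 flin2.
pose F0 (x : free) := \sum_(k <- msupp x) x@_k *: f k.1 k.2.
have F0D : {morph F0 : x y / x + y}.
  apply: (@msupp_sumD _ S M (fun k c => c *: f k.1 k.2)) => k u v.
  by rewrite scalerBl.
have F0U c k : F0 << c *g k >> = c *: f k.1 k.2.
  by apply: (@msupp_sumU _ S M (fun k c => c *: f k.1 k.2)); rewrite scale0r.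
have F00 : F0 0 = 0 by apply: (addrI (F0 0)); rewrite -F0D !addr0.
have F0Z c x : F0 (c *: x) = c *: F0 x.
  rewrite [x]monalgE; elim/big_rec: _ => [|k y _ IHy].
    by rewrite scaler0 F00 scaler0.
  rewrite scalerDr !F0D IHy scalerDr F0U; congr (_ + _).
  rewrite (_ : c *: _ = << c * x@_k *g k >>); first by rewrite F0U scalerA.
  by apply/malgP=> l; rewrite mcoeffZ !mcoeffU mulrnAr.
have F0N x : F0 (- x) = - F0 x by rewrite -[- x]scaleN1r F0Z scaleN1r.
have F0rel x : tensor_rel x -> F0 x = 0.
  elim=> [|c y z _ IHy _ IHz|c a a' b|c a b b'].
  - exact: F00.
  - by rewrite F0D F0Z IHy IHz scaler0 addr0.
  - by rewrite F0D F0N F0D F0Z !F0U /= !scale1r flin1 subrr.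
  - by rewrite F0D F0N F0D F0Z !F0U /= !scale1r flin2 subrr.
pose F (u : tensor) := F0 (repr u).
have Fpi x : F (tensor_pi x) = F0 x.
  apply/eqP; rewrite -subr_eq0 -F0N -F0D F0rel //.
  by apply/tensor_piP; rewrite tensor_repr.
have piZ c x : tensor_pi (c *: x) = c *: tensor_pi x by exact: tensor_piZ.
exists F; split=> [|G [Glin GE]].
  split=> [c u v|a b]; last by rewrite Fpi F0U /= scale1r.
  rewrite -[u]tensor_repr -[v]tensor_repr -piZ -tensor_piD !Fpi.
  by rewrite F0D F0Z.
apply: funext => u; rewrite -[u]tensor_repr Fpi.
have G0 : G 0 = 0 by have:= Glin (-1) 0 0; rewrite scaleN1r !addNr scaleN1r addNr.
rewrite [repr u]monalgE; elim/big_rec: _ => [|k x _ IHx].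
  have -> : tensor_pi 0 = 0 by rewrite -(scale0r 0) piZ scale0r.
  by rewrite F00 G0.
rewrite F0D F0U tensor_piD IHx -GE (surjective_pairing k) -Glin /tens -piZ /=.
by congr (G (tensor_pi _ + _)); apply/malgP=> l; rewrite mcoeffZ !mcoeffU mulrnAr mulr1.
Qed.

End Tensor.

Notation "a ⊗ b" := (tens a b) (at level 40, left associativity) : ring_scope.

(* A C[d]-module is a module over {poly C}, d being the action of 'X and c in *)
(* C acting as c%:P.  The group Z_2 is bool, with addition (+) and            *)
(* multiplication &&; the grading G : bool -> A -> Prop gives the homogeneous *)
(* parts G false and G true.                                                  *)

Section Conformal.
Variables (C : fieldType) (A : lmodType {poly C}).

Record Z2_graded (G : bool -> A -> Prop) : Prop := {
  Z2_graded0 : forall i, G i 0;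
  Z2_gradedP : forall i c a b, G i a -> G i b -> G i (c%:P *: a + b);
  Z2_gradedX : forall i a, G i a -> G i ('X *: a);
  Z2_graded_direct :
    forall a, exists! p : A * A, [/\ G false p.1, G true p.2 & a = p.1 + p.2]
}.

Definition lprod := A -> A -> modpoly A.

Definition lprod_bilinear (o : lprod) : Prop :=
  (forall c a a' b, o (c%:P *: a + a') b = c%:P%:P *: o a b + o a' b) /\
  (forall c a b b', o a (c%:P *: b + b') = c%:P%:P *: o a b + o a b').

(* A[lambda] is a module over C[d][lambda]. *)
Definition d1 : {poly {poly C}} := 'X%:P.
Definition lam1 : {poly {poly C}} := 'X.

Definition subst1 (x : {poly {poly C}}) (p : modpoly A) : modpoly A :=
  modpoly_subst (@modpolyC A) x p.

Record conformal_superalgebra (G : bool -> A -> Prop) (o : lprod) : Prop := {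
  conf_graded : Z2_graded G;
  conf_bilinear : lprod_bilinear o;
  conf_parity : forall i j a b n, G i a -> G j b -> G (i (+) j) (o a b)@_n;
  conf_sesquil : forall a b, o ('X *: a) b = - lam1 *: o a b;
  conf_sesquir : forall a b, o a ('X *: b) = (d1 + lam1) *: o a b
}.

(* A[lambda, mu] is A[lambda][mu], a module over C[d][lambda][mu]. *)
Definition lam : {poly {poly {poly C}}} := 'X%:P.
Definition mu : {poly {poly {poly C}}} := 'X.

Definition subst2 (x : {poly {poly {poly C}}}) (p : modpoly A) :
    modpoly (modpoly A) :=
  modpoly_subst (fun a => modpolyC (modpolyC a)) x p.

(* compr o1 o2 a x b y c is a o1_x (b o2_y c). *)
Definition compr (o1 o2 : lprod) (a : A) (x : {poly {poly {poly C}}}) (b : A)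
    (y : {poly {poly {poly C}}}) (c : A) : modpoly (modpoly A) :=
  \sum_(n <- msupp (o2 b c)) y ^+ n *: subst2 x (o1 a (o2 b c)@_n).

(* compl o1 o2 a x b y c is (a o1_x b) o2_y c. *)
Definition compl (o1 o2 : lprod) (a : A) (x : {poly {poly {poly C}}}) (b : A)
    (y : {poly {poly {poly C}}}) (c : A) : modpoly (modpoly A) :=
  \sum_(n <- msupp (o1 a b)) x ^+ n *: subst2 y (o2 (o1 a b)@_n c).

Definition commutative_conf (G : bool -> A -> Prop) (o : lprod) : Prop :=
  forall i j a b, G i a -> G j b ->
    o a b = (-1) ^+ (i && j) *: subst1 (- d1 - lam1) (o b a).

Definition associative_conf (o : lprod) : Prop :=
  forall a b c, compr o o a lam b mu c = compl o o a lam b (lam + mu) c.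

(* The identity                                                               *)
(*   (a *_lam b) o_(lam+mu) c - a *_lam (b o_mu c)                            *)
(*     = (-1)^(|a||b|) ((b *_mu a) o_(lam+mu) c - b *_mu (a o_lam c));        *)
(* left-symmetry is the case where o is *.                                    *)
Definition left_sym_conf (G : bool -> A -> Prop) (star o : lprod) : Prop :=
  forall i j a b c, G i a -> G j b ->
    compl star o a lam b (lam + mu) c - compr star o a lam b mu c =
    (-1) ^+ (i && j) *:
      (compl star o b mu a (lam + mu) c - compr star o b mu a lam c).

Record left_symmetric_conformal_superalgebra (G : bool -> A -> Prop)
    (star : lprod) : Prop := {
  lsym_conf : conformal_superalgebra G star;
  lsym_lsym : left_sym_conf G star star
}.

Record preLie_Poisson_conformal_superalgebra (G : bool -> A -> Prop)
    (circ star : lprod) : Prop := {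
  plp_circ : conformal_superalgebra G circ;
  plp_comm : commutative_conf G circ;
  plp_assoc : associative_conf circ;
  plp_star : left_symmetric_conformal_superalgebra G star;
  plp_circ_star : forall a b c,
    compl circ star a lam b (lam + mu) c = compr circ star a lam b mu c;
  plp_star_circ : left_sym_conf G star circ
}.

End Conformal.

Section TensorProducts.
Variables (C : fieldType) (L1 L2 : lmodType {poly C}).
Variables (G1 : bool -> L1 -> Prop) (G2 : bool -> L2 -> Prop).

Definition tensor_grading (k : bool) (u : tensor L1 L2) : Prop :=
  exists s : seq (L1 * L2),
    (forall ab, ab \in s ->
       exists i j, [/\ G1 i ab.1, G2 j ab.2 & i (+) j = k]) /\
    u = \sum_(ab <- s) ab.1 ⊗ ab.2.

Definition modpoly_tens (p : modpoly L1) (q : modpoly L2) :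
    modpoly (tensor L1 L2) :=
  \sum_(m <- msupp p) \sum_(n <- msupp q) << p@_m ⊗ q@_n *g (m + n)%N >>.

Definition tensor_circ_spec (circ1 : lprod L1) (circ2 : lprod L2)
    (o : lprod (tensor L1 L2)) : Prop :=
  lprod_bilinear o /\
  forall i j a1 a2 b1 b2, G2 i a2 -> G1 j b1 ->
    o (a1 ⊗ a2) (b1 ⊗ b2) =
    (-1) ^+ (i && j) *: modpoly_tens (circ1 a1 b1) (circ2 a2 b2).

Definition tensor_star_spec (circ1 star1 : lprod L1) (circ2 star2 : lprod L2)
    (o : lprod (tensor L1 L2)) : Prop :=
  lprod_bilinear o /\
  forall i j a1 a2 b1 b2, G2 i a2 -> G1 j b1 ->
    o (a1 ⊗ a2) (b1 ⊗ b2) =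
    (-1) ^+ (i && j) *: (modpoly_tens (star1 a1 b1) (circ2 a2 b2) +
                         modpoly_tens (circ1 a1 b1) (star2 a2 b2)).

End TensorProducts.

(* Main.v *)
Require Import Defs.
From mathcomp Require Import all_boot all_order all_algebra.
From mathcomp Require Import finmap monalg.
From mathcomp Require Import boolp reals complex.

(* The tensor product [p1 ⊗ p2] of two lambda-products, with the Koszul sign, *)
(* turns iterated products into tensor products over C[d][lambda, mu] of      *)
(* iterated products, up to a sign common to both bracketings.  Writing       *)
(* [circ = circ1 ⊗ circ2] and [star = star1 ⊗ circ2 + circ1 ⊗ star2], every   *)
(* identity expands into pairs of identities on the factors.  For             *)
(* left-symmetry, one member of a pair is itself left-symmetric and the other *)
(* satisfies [(a circ b) o c = a circ (b o c)], where both sides are          *)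
(* (super)symmetric in [a] and [b] by commutativity of [circ].                *)

Set Implicit Arguments.
Unset Strict Implicit.
Unset Printing Implicit Defensive.

Import GRing.Theory.

Local Open Scope ring_scope.

(** The Koszul sign depends on the parities of a2 and b1, so the product of pure tensors is defined
    for arbitrary arguments by splitting these two into homogeneous components, and then descended
    to the tensor product over C[d]. Descent works because d acts on a lambda-product as -lambda
    through its left argument and as d + lambda through its right one, by the same polynomials in
    both factors, and the tensor of polynomials is bilinear over C[d][lambda]
    ([tprod_fun_balancedl], [tprod_fun_balancedr]). Homogeneous pure tensors span, hence uniqueness.

    An iterated product is a nested substitution, and substitution commutes with tensoring
    polynomials ([modpoly_subst_lift]). Thus [compl_tprod] and [compr_tprod] write both bracketings
    of p1 ⊗ p2 followed by q1 ⊗ q2 as one and the same sign times a tensor of bracketings in the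
    factors. Associativity-type identities then hold factor by factor.

    For left-symmetry, let P and Q be the two bracketings in one factor, with P - Q = ±(P' - Q')
    after exchanging a and b, and suppose that in the other factor both bracketings equal R, with R
    = ±R'. Then P ⊗ R - Q ⊗ R = (P - Q) ⊗ R has the required symmetry ([tprod_left_sym1],
    [tprod_left_sym2]). The relation R = ±R' comes from commutativity of circ ([compl_comm]). As
    star is a sum of two tensor products, its left-symmetry splits into four such cases, and its
    compatibility with circ into two. *)

(** * Additive maps *)

Lemma morphD0 (U W : zmodType) (f : U -> W) :
  {morph f : x y / x + y} -> f 0 = 0.
Proof. by move=> fD; apply: (addrI (f 0)); rewrite -fD !addr0. Qed.

Lemma morphDN (U W : zmodType) (f : U -> W) :
  {morph f : x y / x + y} -> {morph f : x / - x}.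
Proof. by move=> fD x; apply: (addrI (f x)); rewrite -fD !subrr morphD0. Qed.

Lemma morphDB (U W : zmodType) (f : U -> W) :
  {morph f : x y / x + y} -> {morph f : x y / x - y}.
Proof. by move=> fD x y; rewrite fD morphDN. Qed.

Lemma morphD_sum (U W : zmodType) (f : U -> W) (I : Type) (r : seq I) (F : I -> U) :
  {morph f : x y / x + y} -> f (\sum_(i <- r) F i) = \sum_(i <- r) f (F i).
Proof. by move=> fD; apply: (big_morph f fD); apply: morphD0. Qed.

(** The two signs live in different rings: additive maps between modules over different rings still
    commute with signs, which is how Koszul signs leave substitutions and coefficients. *)
Lemma morphD_sign (S S' : nzRingType) (U : lmodType S) (W : lmodType S')
    (f : U -> W) (b : bool) u :
  {morph f : x y / x + y} -> f ((-1) ^+ b *: u) = (-1) ^+ b *: f u.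
Proof. by move=> fD; rewrite !scaler_sign; case: b; rewrite ?morphDN. Qed.

Lemma mcoeff_is_morphD (V : zmodType) n :
  {morph (fun p : modpoly V => p@_n) : p q / p + q}.
Proof. by move=> p q; rewrite mcoeffD. Qed.

Lemma modpoly_scaleU (S : nzRingType) (V : lmodType S) (c : S) i (v : V) n :
  (c%:P * 'X^i) *: (<< v *g n >> : modpoly V) = << c *: v *g (i + n)%N >>.
Proof. exact: modpoly_scaleMX. Qed.

(** * Substitution *)

Section Subst.
Variables (S : comNzRingType) (V : zmodType) (M : lmodType S).
Implicit Types (iota : V -> M) (x : S) (p q : modpoly V).

Lemma modpoly_substD iota x : {morph iota : u v / u + v} ->
  {morph modpoly_subst iota x : p q / p + q}.
Proof.
move=> iotaD; apply: (@msupp_sumD _ V M (fun n v => x ^+ n *: iota v)).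
by move=> n u v; rewrite morphDB // scalerBr.
Qed.

Lemma modpoly_substU iota x n v : {morph iota : u v / u + v} ->
  modpoly_subst iota x << v *g n >> = x ^+ n *: iota v.
Proof.
move=> iotaD; apply: (@msupp_sumU _ V M (fun n v => x ^+ n *: iota v)).
by rewrite morphD0 // scaler0.
Qed.

Lemma modpoly_subst_add iota iota' x p :
  modpoly_subst (fun v => iota v + iota' v) x p =
  modpoly_subst iota x p + modpoly_subst iota' x p.
Proof.
by rewrite /modpoly_subst -big_split; apply: eq_bigr => n _; rewrite scalerDr.
Qed.

End Subst.

(** By iteration [h] turns the action of each power of [x] into that of the same power of [x']. This
    serves both to compose substitutions and to rename variables. *)
Lemma modpoly_subst_comp (S S' : comNzRingType) (V : zmodType) (M : lmodType S)
    (M' : lmodType S') (h : M -> M') (iota : V -> M) (x : S) (x' : S') p :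
  {morph h : u v / u + v} -> (forall u, h (x *: u) = x' *: h u) ->
  h (modpoly_subst iota x p) = modpoly_subst (h \o iota) x' p.
Proof.
move=> hD hx; rewrite /modpoly_subst morphD_sum //; apply: eq_bigr => n _ /=.
by elim: n (p@_n) => [|n IHn] v; rewrite ?expr0 ?scale1r // !exprS -!scalerA hx IHn.
Qed.

Section SubstScale.
Variables (S S' : comNzRingType) (V : lmodType S) (M : lmodType S').
Variables (iota : V -> M) (x : S').
Hypothesis iotaD : {morph iota : u v / u + v}.

Lemma modpoly_substX (p : modpoly V) :
  modpoly_subst iota x (('X : {poly S}) *: p) = x *: modpoly_subst iota x p.
Proof.
elim/(@modpoly_ind S): p => [|p q IHp IHq|v n].
- by rewrite scaler0 morphD0 ?scaler0 //; apply: modpoly_substD.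
- by rewrite scalerDr !modpoly_substD // IHp IHq scalerDr.
have -> : 'X *: (<< v *g n >> : modpoly V) = << v *g n.+1 >>.
  by have:= modpoly_scaleMX 1 1 v n; rewrite mul1r expr1 scale1r.
by rewrite !modpoly_substU // exprS scalerA.
Qed.

Lemma modpoly_substC c c' (p : modpoly V) :
  (forall v, iota (c *: v) = c' *: iota v) ->
  modpoly_subst iota x (c%:P *: p) = c' *: modpoly_subst iota x p.
Proof.
move=> iotac; elim/(@modpoly_ind S): p => [|p q IHp IHq|v n].
- by rewrite scaler0 morphD0 ?scaler0 //; apply: modpoly_substD.
- by rewrite scalerDr !modpoly_substD // IHp IHq scalerDr.
have -> : c%:P *: (<< v *g n >> : modpoly V) = << c *: v *g n >>.
  by have:= modpoly_scaleMX c 0 v n; rewrite expr0 mulr1.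
by rewrite !modpoly_substU // iotac !scalerA mulrC.
Qed.

End SubstScale.

(** * Bilinear maps *)

Definition bilin (S : nzRingType) (U V W : lmodType S) (B : U -> V -> W) :=
  (forall v, linear (B^~ v)) /\ (forall u, linear (B u)).

Section Bilin.
Variables (S : nzRingType) (U V W : lmodType S) (B : U -> V -> W).
Hypothesis linB : bilin B.

Lemma bilinDl v : {morph B^~ v : x y / x + y}.
Proof. by move=> x y; have:= linB.1 v 1 x y; rewrite !scale1r. Qed.

Lemma bilinDr u : {morph B u : x y / x + y}.
Proof. by move=> x y; have:= linB.2 u 1 x y; rewrite !scale1r. Qed.

Lemma bilinZl c u v : B (c *: u) v = c *: B u v.
Proof.
have:= linB.1 v c u 0; rewrite !addr0 => ->.
by rewrite (morphD0 (bilinDl v)) addr0.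
Qed.

Lemma bilinZr c u v : B u (c *: v) = c *: B u v.
Proof.
have:= linB.2 u c v 0; rewrite !addr0 => ->.
by rewrite (morphD0 (bilinDr u)) addr0.
Qed.

End Bilin.

(** The Cauchy product with [B] in place of multiplication. For [B = tens] it is [modpoly_tens];
    lifting once more gives the tensor in two variables, [tens2]. *)
Definition modpoly_lift (U V W : zmodType) (B : U -> V -> W)
    (p : modpoly U) (q : modpoly V) : modpoly W :=
  \sum_(m <- msupp p) \sum_(n <- msupp q) << B p@_m q@_n *g (m + n)%N >>.

Section Lift.
Variables (S : nzRingType) (U V W : lmodType S) (B : U -> V -> W).
Hypothesis linB : bilin B.

Lemma modpoly_liftDl q : {morph (modpoly_lift B)^~ q : x y / x + y}.
Proof.
apply: (@msupp_sumD _ U (modpoly W)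
  (fun m v => \sum_(n <- msupp q) << B v q@_n *g (m + n)%N >>)) => m u v.
rewrite -sumrB; apply: eq_bigr => n _.
by rewrite (morphDB (bilinDl linB _)) monalgUB.
Qed.

Lemma modpoly_liftDr p : {morph modpoly_lift B p : x y / x + y}.
Proof.
move=> x y; rewrite /modpoly_lift -big_split; apply: eq_bigr => m _ /=.
apply: (@msupp_sumD _ V (modpoly W) (fun n v => << B p@_m v *g (m + n)%N >>)).
by move=> n u v; rewrite (morphDB (bilinDr linB _)) monalgUB.
Qed.

Lemma modpoly_liftUU u v m n :
  modpoly_lift B << u *g m >> << v *g n >> = << B u v *g (m + n)%N >>.
Proof.
have B0 w : B 0 w = 0 by apply: (morphD0 (bilinDl linB w)).
pose q : modpoly V := << v *g n >>.
apply: etrans (@msupp_sumU _ U (modpoly W)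
  (fun m u => \sum_(n <- msupp q) << B u q@_n *g (m + n)%N >>) m u _) _.
  by apply: big1 => k _; rewrite B0 monalgU0.
apply: (@msupp_sumU _ V (modpoly W) (fun n v => << B u v *g (m + n)%N >>)).
by rewrite (morphD0 (bilinDr linB u)) monalgU0.
Qed.

(** Bilinearity is over [{poly S}], so the lift can be iterated. By additivity everything reduces to
    monomials, where it is associativity and commutativity of the exponents. *)
Lemma modpoly_lift_bilin :
  bilin (modpoly_lift B : modpoly U -> modpoly V -> modpoly W).
Proof.
have lift0l q : modpoly_lift B 0 q = 0 by apply: (morphD0 (modpoly_liftDl q)).
have lift0r p : modpoly_lift B p 0 = 0 by apply: (morphD0 (modpoly_liftDr p)).
have liftZ (f : {poly S}) (p : modpoly U) (q : modpoly V) :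
     modpoly_lift B (f *: p) q = f *: (modpoly_lift B p q : modpoly W)
  /\ modpoly_lift B p (f *: q) = f *: (modpoly_lift B p q : modpoly W).
  elim/(@modpoly_ind S): p => [|p p' [p1 p2] [p1' p2']|u m].
  - by rewrite !(scaler0, lift0l).
  - by rewrite scalerDr !modpoly_liftDl scalerDr p1 p2 p1' p2'.
  elim/(@modpoly_ind S): q => [|q q' [q1 q2] [q1' q2']|v n].
  - by rewrite !(scaler0, lift0r).
  - by rewrite scalerDr !modpoly_liftDr scalerDr q1 q2 q1' q2'.
  elim/modpoly_poly_ind: f => [f g [f1 f2] [g1 g2]|c i].
    by rewrite !scalerDl modpoly_liftDl modpoly_liftDr f1 f2 g1 g2.
  rewrite !modpoly_scaleU !modpoly_liftUU modpoly_scaleU (bilinZl linB).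
  by rewrite (bilinZr linB) [(m + (i + n))%N]addnCA !addnA.
by split=> [q f p p'|p f q q'];
  rewrite (modpoly_liftDl, modpoly_liftDr) 1?(liftZ _ _ _).1 1?(liftZ _ _ _).2.
Qed.

End Lift.

(** This is x^(m+n) = x^m x^n. Compatibility of [f] with [B'] is asked at the coefficients of [p]
    and [q] alone, because the factor [e] will be a Koszul sign determined by the parity of those
    coefficients. *)
Lemma modpoly_subst_lift (S S' : comNzRingType) (U V W : lmodType S)
    (M1 M2 M : lmodType S') (B : U -> V -> W) (B' : M1 -> M2 -> M)
    (f : W -> M) (g : U -> M1) (h : V -> M2) (x e : S') p q :
  bilin B' -> {morph f : u v / u + v} ->
  (forall m n, f (B p@_m q@_n) = e *: B' (g p@_m) (h q@_n)) ->
  modpoly_subst f x (modpoly_lift B p q) =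
  e *: B' (modpoly_subst g x p) (modpoly_subst h x q).
Proof.
move=> linB' fD fB; rewrite [in RHS]/modpoly_subst.
rewrite (morphD_sum _ _ (bilinDl linB' _)) scaler_sumr.
rewrite (morphD_sum _ _ (modpoly_substD x fD)); apply: eq_bigr => m _.
rewrite (morphD_sum _ _ (bilinDr linB' _)) scaler_sumr.
rewrite (morphD_sum _ _ (modpoly_substD x fD)); apply: eq_bigr => n _.
rewrite modpoly_substU // fB (bilinZl linB') (bilinZr linB') !scalerA.
by rewrite exprD mulrC mulrA.
Qed.

(** * The tensor product *)

Lemma tens_bilin (S : comNzRingType) (L1 L2 : lmodType S) :
  bilin (@tens S L1 L2).
Proof. by split=> [v c x y|u c x y]; rewrite (tensPl, tensPr). Qed.

Lemma tensDl (S : comNzRingType) (L1 L2 : lmodType S) (a a' : L1) (b : L2) :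
  (a + a') ⊗ b = a ⊗ b + a' ⊗ b.
Proof. exact: (bilinDl (tens_bilin L1 L2)). Qed.

Lemma tensDr (S : comNzRingType) (L1 L2 : lmodType S) (a : L1) (b b' : L2) :
  a ⊗ (b + b') = a ⊗ b + a ⊗ b'.
Proof. exact: (bilinDr (tens_bilin L1 L2)). Qed.

(* Unlike [tensor_universal], this asks for no [S]-module structure on [W]:   *)
(* the lambda-products are balanced over C[d], but not C[d]-linear.           *)
Section TensorLift.
Variables (S : comNzRingType) (L1 L2 : lmodType S) (W : zmodType).
Variable f : L1 -> L2 -> W.

Definition balanced :=
  [/\ forall b, {morph f^~ b : x y / x + y}, forall a, {morph f a : x y / x + y}
    & forall c a b, f (c *: a) b = f a (c *: b)].

(** As [W] carries no action of [S], the coefficient of a generator is absorbed into its first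
    component. *)
Definition free_lift (x : {malg S[(L1 * L2)%type]}) : W :=
  \sum_(k <- msupp x) f (x@_k *: k.1) k.2.

Definition tensor_lift (u : tensor L1 L2) : W := free_lift (repr u).

Hypothesis balf : balanced.

Let fDl b : {morph f^~ b : x y / x + y}. Proof. by case: balf. Qed.
Let fDr a : {morph f a : x y / x + y}. Proof. by case: balf. Qed.

Lemma free_liftD : {morph free_lift : x y / x + y}.
Proof.
apply: (@msupp_sumD _ S W (fun k c => f (c *: k.1) k.2)) => k c d.
by rewrite scalerBl (morphDB (fDl k.2)).
Qed.

Lemma free_liftU c k : free_lift << c *g k >> = f (c *: k.1) k.2.
Proof.
apply: (@msupp_sumU _ S W (fun k c => f (c *: k.1) k.2)).
by rewrite scale0r (morphD0 (fDl k.2)).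
Qed.

Lemma free_liftZU c d k : free_lift (c *: << d *g k >>) = f ((c * d) *: k.1) k.2.
Proof.
rewrite -free_liftU; congr free_lift.
by apply/malgP=> l; rewrite mcoeffZ !mcoeffU mulrnAr.
Qed.

Lemma free_liftZ1 c a b : free_lift (c *: << (a, b) >>) = f (c *: a) b.
Proof. by rewrite free_liftZU mulr1. Qed.

Lemma free_lift_comb c d x y z u v w :
  free_lift (c *: x) = u -> free_lift ((c * d) *: y) = v ->
  free_lift (c *: z) = w -> u = v + w ->
  free_lift (c *: (x - (d *: y + z))) = 0.
Proof.
move=> Ex Ey Ez uvw; rewrite scalerBr scalerDr scalerA (morphDB free_liftD).
by rewrite free_liftD Ex Ey Ez uvw subrr.
Qed.

(** The scalar [c] is there for the induction: a relation may be built by scaling another one, and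
    [free_lift] cannot move that scalar outside. *)
Lemma free_lift_rel x c : tensor_rel x -> free_lift (c *: x) = 0.
Proof.
case: (balf) => _ _ fZ.
move=> relx; elim: relx c => {x} [|d x y _ IHx _ IHy|d a a' b|d a b b'] c.
- by rewrite scaler0 (morphD0 free_liftD).
- by rewrite scalerDr free_liftD scalerA IHx IHy addr0.
- apply: (free_lift_comb (free_liftZ1 _ _ _) (free_liftZ1 _ _ _) (free_liftZ1 _ _ _)).
  by rewrite scalerDr fDl scalerA.
- apply: (free_lift_comb (free_liftZ1 _ _ _) (free_liftZ1 _ _ _) (free_liftZ1 _ _ _)).
  by rewrite fDr -fZ scalerA mulrC.
Qed.

Lemma tensor_lift_pi x : tensor_lift (tensor_pi x) = free_lift x.
Proof.
apply/eqP; rewrite -subr_eq0 -(morphDB free_liftD) -[_ - _]scale1r free_lift_rel //.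
by apply/tensor_piP; rewrite tensor_repr.
Qed.

Lemma tensor_liftD : {morph tensor_lift : u v / u + v}.
Proof.
move=> u v; rewrite -[u]tensor_repr -[v]tensor_repr -tensor_piD.
by rewrite !tensor_lift_pi free_liftD.
Qed.

Lemma tensor_lift_tens a b : tensor_lift (a ⊗ b) = f a b.
Proof. by rewrite tensor_lift_pi free_liftU scale1r. Qed.

End TensorLift.

Lemma tensor_ind (S : comNzRingType) (L1 L2 : lmodType S)
    (Q : tensor L1 L2 -> Prop) :
  Q 0 -> (forall u v, Q u -> Q v -> Q (u + v)) -> (forall a b, Q (a ⊗ b)) ->
  forall u, Q u.
Proof.
move=> Q0 QD QT u; have [s ->] := tens_span u.
by elim/big_rec: _ => // k v _; apply: QD.
Qed.

(** * Gradings *)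

Section Grading.
Variables (C : fieldType) (A : lmodType {poly C}).
Implicit Types (G : bool -> A -> Prop) (pi : bool -> A -> A).

(** A grading presented by its two C[d]-linear projections, so that parity-dependent formulas extend
    to non-homogeneous elements. *)
Record homproj G pi : Prop := {
  homproj_linear : forall i, linear (pi i);
  homproj_in : forall i a, G i (pi i a);
  homproj_sum : forall a, a = pi false a + pi true a;
  homproj_id : forall i j a, G i a -> pi j a = if i == j then a else 0
}.

Lemma homprojD G pi i : homproj G pi -> {morph pi i : a b / a + b}.
Proof. by move=> pG a b; have:= homproj_linear pG i 1 a b; rewrite !scale1r. Qed.

Lemma homprojZ G pi i c a : homproj G pi -> pi i (c *: a) = c *: pi i a.
Proof.
move=> pG; have:= homproj_linear pG i c a 0.
by rewrite !addr0 (morphD0 (homprojD i pG)) addr0.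
Qed.

Lemma Z2_gradedD G i a b : Z2_graded G -> G i a -> G i b -> G i (a + b).
Proof. by move=> gr Ga Gb; rewrite -[a]scale1r -polyC1; apply: Z2_gradedP. Qed.

Lemma Z2_gradedZ G i c a : Z2_graded G -> G i a -> G i (c *: a).
Proof.
move=> gr; elim/poly_ind: c a => [|f c IHf] a Ga.
  by rewrite scale0r; apply: Z2_graded0.
rewrite scalerDl addrC -scalerA; apply: Z2_gradedP => //.
by apply: IHf; apply: Z2_gradedX.
Qed.

(** Choice picks a decomposition of each element. By uniqueness any homogeneous decomposition is the
    chosen one ([piE]), which gives both linearity and the values on homogeneous elements. *)
Lemma Z2_graded_homproj G : Z2_graded G -> exists pi, homproj G pi.
Proof.
move=> gr; have [pi piP] := choice (Z2_graded_direct gr).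
have piE a p q : G false p -> G true q -> a = p + q -> pi a = (p, q).
  by move=> Gp Gq aE; apply: (piP a).2.
have pi0 a : G false (pi a).1 by case: (piP a) => -[].
have pi1 a : G true (pi a).2 by case: (piP a) => -[].
have piS a : a = (pi a).1 + (pi a).2 by case: (piP a) => -[].
exists (fun i a => if i then (pi a).2 else (pi a).1); split=> //.
- move=> i c a b; rewrite (piE _ (c *: (pi a).1 + (pi b).1) (c *: (pi a).2 + (pi b).2)).
  + by case: i.
  + by apply: Z2_gradedD => //; apply: Z2_gradedZ.
  + by apply: Z2_gradedD => //; apply: Z2_gradedZ.
  + by rewrite addrACA -scalerDr -!piS.
- by case.
- case=> j a Ga.
    by rewrite (piE a 0 a) ?add0r //; apply: Z2_graded0.
  by rewrite (piE a a 0) ?addr0 //; [case: j | apply: Z2_graded0].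
Qed.

End Grading.

Section TensorGrading.
Variables (C : fieldType) (L1 L2 : lmodType {poly C}).
Variables (G1 : bool -> L1 -> Prop) (G2 : bool -> L2 -> Prop).

Lemma tensor_grading0 k : tensor_grading G1 G2 k 0.
Proof. by exists [::]; rewrite big_nil. Qed.

Lemma tensor_gradingD k u v : tensor_grading G1 G2 k u ->
  tensor_grading G1 G2 k v -> tensor_grading G1 G2 k (u + v).
Proof.
move=> [s [sP ->]] [t [tP ->]]; exists (s ++ t); split; last by rewrite big_cat.
by move=> ab; rewrite mem_cat => /orP[/sP|/tP].
Qed.

Lemma tensor_grading_tens i j a b : G1 i a -> G2 j b ->
  tensor_grading G1 G2 (i (+) j) (a ⊗ b).
Proof.
move=> Ga Gb; exists [:: (a, b)]; split; last by rewrite big_seq1.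
by move=> ab; rewrite inE => /eqP->; exists i, j.
Qed.

Lemma tensor_grading_ind k (Q : tensor L1 L2 -> Prop) :
  Q 0 -> (forall u v, Q u -> Q v -> Q (u + v)) ->
  (forall i j a b, G1 i a -> G2 j b -> i (+) j = k -> Q (a ⊗ b)) ->
  forall u, tensor_grading G1 G2 k u -> Q u.
Proof.
move=> Q0 QD QT u [s [sP ->]]; rewrite big_seq; elim/big_rec: _ => // ab v abs.
by have [i [j [Ga Gb ij]]] := sP _ abs; apply: QD; apply: QT ij.
Qed.

Hypotheses (gr1 : Z2_graded G1) (gr2 : Z2_graded G2).

Lemma tensor_gradingZ k c u : tensor_grading G1 G2 k u ->
  tensor_grading G1 G2 k (c *: u).
Proof.
elim/tensor_grading_ind => {u} [|u v IHu IHv|i j a b Ga Gb <-].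
- by rewrite scaler0; apply: tensor_grading0.
- by rewrite scalerDr; apply: tensor_gradingD.
by rewrite -tensZl; apply: tensor_grading_tens => //; apply: Z2_gradedZ.
Qed.

Lemma tensor_Z2_graded : Z2_graded (tensor_grading G1 G2).
Proof.
have [pi1 pG1] := Z2_graded_homproj gr1; have [pi2 pG2] := Z2_graded_homproj gr2.
(* The projection onto degree k of the tensor product: the sum over i of [pi1 i] ⊗
   [pi2 (i (+) k)]. *)
pose f k a b := pi1 false a ⊗ pi2 k b + pi1 true a ⊗ pi2 (~~ k) b.
have balf k : balanced (f k).
  split=> [b a a'|a b b'|c a b]; rewrite /f.
  - by rewrite !(homprojD _ pG1) !tensDl addrACA.
  - by rewrite !(homprojD _ pG2) !tensDr addrACA.
  - rewrite !(homprojZ _ _ _ pG1) !(homprojZ _ _ _ pG2).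
    by rewrite !(bilinZl (tens_bilin _ _)) !(bilinZr (tens_bilin _ _)).
pose pi k u := tensor_lift (f k) u.
have piD k : {morph pi k : u v / u + v} by apply: tensor_liftD.
have piT k a b : pi k (a ⊗ b) = f k a b by apply: tensor_lift_tens.
have pi_in k u : tensor_grading G1 G2 k (pi k u).
  elim/tensor_ind: u => [|u v IHu IHv|a b].
  - by rewrite (morphD0 (piD k)); apply: tensor_grading0.
  - by rewrite piD; apply: tensor_gradingD.
  rewrite piT; apply: tensor_gradingD.
    apply: (@tensor_grading_tens false); first exact: (homproj_in pG1).
    exact: (homproj_in pG2).
  rewrite -{1}[k]negbK.
  apply: (@tensor_grading_tens true); first exact: (homproj_in pG1).
  exact: (homproj_in pG2).
have pi_id k l u : tensor_grading G1 G2 k u -> pi l u = if k == l then u else 0.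
  elim/tensor_grading_ind => {u} [|u v IHu IHv|i j a b Ga Gb <-].
  - by rewrite (morphD0 (piD l)) if_same.
  - by rewrite piD IHu IHv; case: eqP; rewrite ?addr0.
  rewrite piT /f !(homproj_id pG1 _ Ga) !(homproj_id pG2 _ Gb).
  have T0 x : (0 : L1) ⊗ x = 0 :> tensor L1 L2 by apply: tens0l.
  have T0r x : x ⊗ (0 : L2) = 0 :> tensor L1 L2.
    by apply: (morphD0 (bilinDr (tens_bilin _ _) x)).
  by case: i j l {Ga Gb} => [] [] [] /=; rewrite ?T0 ?T0r ?addr0 ?add0r.
have pi_sum u : u = pi false u + pi true u.
  elim/tensor_ind: u => [|u v IHu IHv|a b].
  - by rewrite !(morphD0 (piD _)) addr0.
  - by rewrite !piD addrACA -IHu -IHv.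
  rewrite !piT /f /= addrACA -!tensDr [pi2 true b + _]addrC.
  by rewrite -(homproj_sum pG2) -tensDl -(homproj_sum pG1).
split.
- exact: tensor_grading0.
- by move=> k c u v Gu Gv; apply: tensor_gradingD => //; apply: tensor_gradingZ.
- by move=> k u; apply: tensor_gradingZ.
move=> u; exists (pi false u, pi true u); split=> [|[p q] [/= Gp Gq ->]].
  by split; [apply: pi_in | apply: pi_in | apply: pi_sum].
by rewrite !piD !(pi_id _ _ _ Gp) !(pi_id _ _ _ Gq) /= addr0 add0r.
Qed.

End TensorGrading.

(** * Sesquilinear products *)

Definition biadd (U V W : zmodType) (o : U -> V -> W) :=
  (forall v, {morph o^~ v : x y / x + y}) /\ (forall u, {morph o u : x y / x + y}).

Lemma tensor_ext (S : comNzRingType) (L1 L2 : lmodType S) (W : zmodType)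
    (f g : tensor L1 L2 -> W) :
  {morph f : u v / u + v} -> {morph g : u v / u + v} ->
  (forall a b, f (a ⊗ b) = g (a ⊗ b)) -> f =1 g.
Proof.
move=> fD gD fg; elim/tensor_ind => [|u v IHu IHv|a b]; last exact: fg.
  by rewrite !morphD0.
by rewrite fD gD IHu IHv.
Qed.

Lemma tensor_biext (S : comNzRingType) (L1 L2 : lmodType S) (W : zmodType)
    (o o' : tensor L1 L2 -> tensor L1 L2 -> W) :
  biadd o -> biadd o' ->
  (forall a1 a2 b1 b2, o (a1 ⊗ a2) (b1 ⊗ b2) = o' (a1 ⊗ a2) (b1 ⊗ b2)) ->
  forall u v, o u v = o' u v.
Proof.
move=> [oDl oDr] [oDl' oDr'] oo' u v.
apply: (tensor_ext (oDl v) (oDl' v)) => a1 a2.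
by apply: (tensor_ext (oDr _) (oDr' _)) => b1 b2.
Qed.

Lemma tensor_biadd (S : comNzRingType) (U : zmodType) (L1 L2 : lmodType S)
    (W : zmodType) (o : U -> tensor L1 L2 -> W) :
  (forall u, {morph o u : v w / v + w}) ->
  (forall b1 b2, {morph o^~ (b1 ⊗ b2) : u v / u + v}) -> biadd o.
Proof.
move=> oDr oDl; split=> // v u u'; elim/tensor_ind: v => [|v w IHv IHw|b1 b2].
- by rewrite !(morphD0 (oDr _)) addr0.
- by rewrite !oDr IHv IHw addrACA.
exact: oDl.
Qed.

Section Sesquilinear.
Variables (C : fieldType) (A : lmodType {poly C}).

(** The conditions of [conformal_superalgebra] that do not mention the grading; these make the
    tensor product of two lambda-products well defined. *)
Definition sesquilinear (o : lprod A) :=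
  [/\ @lprod_bilinear C A o, forall a b, o ('X *: a) b = - lam1 C *: o a b
    & forall a b, o a ('X *: b) = (d1 C + lam1 C) *: o a b].

Lemma conf_sesquilinear G o : conformal_superalgebra G o -> sesquilinear o.
Proof. by case. Qed.

Lemma bilinear_biadd (o : lprod A) : lprod_bilinear o -> biadd o.
Proof.
move=> [oZl oZr]; split=> [b x y|a x y].
  by have:= oZl 1 x y b; rewrite !polyC1 !scale1r.
by have:= oZr 1 a x y; rewrite !polyC1 !scale1r.
Qed.

Lemma sesquilinear_biadd (o : lprod A) : sesquilinear o -> biadd o.
Proof. by move=> [/bilinear_biadd]. Qed.

Lemma sesquilinearCl (o : lprod A) c a b : sesquilinear o ->
  o (c%:P *: a) b = c%:P%:P *: o a b.
Proof.
move=> so; case: (so) => -[oZl _] _ _; have:= oZl c a 0 b.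
by rewrite !addr0 (morphD0 ((sesquilinear_biadd so).1 b)) addr0.
Qed.

Lemma sesquilinearCr (o : lprod A) c a b : sesquilinear o ->
  o a (c%:P *: b) = c%:P%:P *: o a b.
Proof.
move=> so; case: (so) => -[_ oZr] _ _; have:= oZr c a b 0.
by rewrite !addr0 (morphD0 ((sesquilinear_biadd so).2 a)) addr0.
Qed.

Lemma sesquilinearI (o : lprod A) : biadd o ->
  (forall c a b, o (c%:P *: a) b = c%:P%:P *: o a b) ->
  (forall c a b, o a (c%:P *: b) = c%:P%:P *: o a b) ->
  (forall a b, o ('X *: a) b = - lam1 C *: o a b) ->
  (forall a b, o a ('X *: b) = (d1 C + lam1 C) *: o a b) ->
  sesquilinear o.
Proof.
move=> [oDl oDr] oCl oCr oXl oXr; split=> //.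
by split=> [c a a' b|c a b b']; rewrite (oDl, oDr) (oCl, oCr).
Qed.

End Sesquilinear.

(** C[d] is generated by C and d, so the scalars that can be moved across are all of C[d] once they
    include these. *)
Lemma balanced_poly (C : fieldType) (L1 L2 : lmodType {poly C}) (W : zmodType)
    (f : L1 -> L2 -> W) :
  biadd f -> (forall c a b, f (c%:P *: a) b = f a (c%:P *: b)) ->
  (forall a b, f ('X *: a) b = f a ('X *: b)) -> balanced f.
Proof.
move=> [fDl fDr] fC fX; split=> // c a b.
elim/poly_ind: c a b => [|g c IHg] a b.
  by rewrite !scale0r (morphD0 (fDl b)) (morphD0 (fDr a)).
by rewrite !scalerDl fDl fDr fC -scalerA IHg fX scalerA mulrC.
Qed.

(** Prepares the second of two successive lifts: balance in the arguments [b1], [b2] passes from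
    pure tensors to every [u] by additivity in [u]. *)
Lemma balanced_param (S : comNzRingType) (L1 L2 M1 M2 : lmodType S)
    (W : zmodType) (g : M1 -> M2 -> tensor L1 L2 -> W) (f : L1 -> L2 -> M1 -> M2 -> W) :
  (forall b1 b2, {morph g b1 b2 : u v / u + v}) ->
  (forall b1 b2 a1 a2, g b1 b2 (a1 ⊗ a2) = f a1 a2 b1 b2) ->
  (forall a1 a2, balanced (f a1 a2)) ->
  forall u, balanced (fun b1 b2 => g b1 b2 u).
Proof.
move=> gD gE balf; elim/tensor_ind => [|u v [uDl uDr uZ] [vDl vDr vZ]|a1 a2].
- by split=> [b x y|a x y|c a b]; rewrite !(morphD0 (gD _ _)) ?addr0.
- split=> [b x y|a x y|c a b]; rewrite !gD; last by rewrite uZ vZ.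
    by rewrite uDl vDl addrACA.
  by rewrite uDr vDr addrACA.
have [fDl fDr fZ] := balf a1 a2.
by split=> [b x y|a x y|c a b]; rewrite !gE; [apply: fDl | apply: fDr | apply: fZ].
Qed.

Section TensorProduct.
Variables (C : fieldType) (L1 L2 : lmodType {poly C}).
Variables (G1 : bool -> L1 -> Prop) (G2 : bool -> L2 -> Prop).
Variables (pi1 : bool -> L1 -> L1) (pi2 : bool -> L2 -> L2).
Variables (p1 : lprod L1) (p2 : lprod L2).

(** The signed formula extended additively: only [a2] and [b1], whose parities enter the sign, are
    split. *)
Definition tprod_fun a1 a2 b1 b2 : modpoly (tensor L1 L2) :=
  \sum_(i : bool) \sum_(j : bool)
    (-1) ^+ (i && j) *: modpoly_tens (p1 a1 (pi1 j b1)) (p2 (pi2 i a2) b2).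

Definition tprod : lprod (tensor L1 L2) := fun u v =>
  tensor_lift (fun b1 b2 => tensor_lift (fun a1 a2 => tprod_fun a1 a2 b1 b2) u) v.

Hypotheses (pG1 : homproj G1 pi1) (pG2 : homproj G2 pi2).
Hypotheses (s1 : sesquilinear p1) (s2 : sesquilinear p2).

Lemma modpoly_tens_bilin :
  bilin (@modpoly_tens C L1 L2 : modpoly L1 -> modpoly L2 -> modpoly (tensor L1 L2)).
Proof. exact: (modpoly_lift_bilin (tens_bilin L1 L2)). Qed.

Let TDl := bilinDl modpoly_tens_bilin.
Let TDr := bilinDr modpoly_tens_bilin.
Let TZl := bilinZl modpoly_tens_bilin.
Let TZr := bilinZr modpoly_tens_bilin.

Lemma tprod_funDl b1 b2 : biadd (fun a1 a2 => tprod_fun a1 a2 b1 b2).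
Proof.
have [[p1D _] [p2D _]] := (sesquilinear_biadd s1, sesquilinear_biadd s2).
split=> [a2 x y|a1 x y]; rewrite /tprod_fun -big_split; apply: eq_bigr => i _ /=;
  rewrite -big_split; apply: eq_bigr => j _ /=.
  by rewrite p1D TDl scalerDr.
by rewrite (homprojD _ pG2) p2D TDr scalerDr.
Qed.

Lemma tprod_funDr a1 a2 : biadd (fun b1 b2 => tprod_fun a1 a2 b1 b2).
Proof.
have [[_ p1D] [_ p2D]] := (sesquilinear_biadd s1, sesquilinear_biadd s2).
split=> [b2 x y|b1 x y]; rewrite /tprod_fun -big_split; apply: eq_bigr => i _ /=;
  rewrite -big_split; apply: eq_bigr => j _ /=.
  by rewrite (homprojD _ pG1) p1D TDl scalerDr.
by rewrite p2D TDr scalerDr.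
Qed.

Lemma tprod_funZl c t a1 a2 b1 b2 :
  (forall a b, p1 (c *: a) b = t *: p1 a b) ->
  tprod_fun (c *: a1) a2 b1 b2 = t *: tprod_fun a1 a2 b1 b2.
Proof.
move=> p1Z; rewrite scaler_sumr; apply: eq_bigr => i _.
rewrite scaler_sumr; apply: eq_bigr => j _.
by rewrite p1Z TZl !scalerA mulrC.
Qed.

Lemma tprod_funZl2 c t a1 a2 b1 b2 :
  (forall a b, p2 (c *: a) b = t *: p2 a b) ->
  tprod_fun a1 (c *: a2) b1 b2 = t *: tprod_fun a1 a2 b1 b2.
Proof.
move=> p2Z; rewrite scaler_sumr; apply: eq_bigr => i _.
rewrite scaler_sumr; apply: eq_bigr => j _.
by rewrite (homprojZ _ _ _ pG2) p2Z TZr !scalerA mulrC.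
Qed.

Lemma tprod_funZr c t a1 a2 b1 b2 :
  (forall a b, p1 a (c *: b) = t *: p1 a b) ->
  tprod_fun a1 a2 (c *: b1) b2 = t *: tprod_fun a1 a2 b1 b2.
Proof.
move=> p1Z; rewrite scaler_sumr; apply: eq_bigr => i _.
rewrite scaler_sumr; apply: eq_bigr => j _.
by rewrite (homprojZ _ _ _ pG1) p1Z TZl !scalerA mulrC.
Qed.

Lemma tprod_funZr2 c t a1 a2 b1 b2 :
  (forall a b, p2 a (c *: b) = t *: p2 a b) ->
  tprod_fun a1 a2 b1 (c *: b2) = t *: tprod_fun a1 a2 b1 b2.
Proof.
move=> p2Z; rewrite scaler_sumr; apply: eq_bigr => i _.
rewrite scaler_sumr; apply: eq_bigr => j _.
by rewrite p2Z TZr !scalerA mulrC.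
Qed.

(** Scaling [a1] or [a2] by d multiplies the result by the same -lambda, since [modpoly_tens] is
    bilinear over C[d][lambda]; likewise for constants. *)
Lemma tprod_fun_balancedl b1 b2 : balanced (fun a1 a2 => tprod_fun a1 a2 b1 b2).
Proof.
apply: balanced_poly => [|c a b|a b]; first exact: tprod_funDl.
  rewrite (@tprod_funZl c%:P c%:P%:P) => [|x y]; last exact: sesquilinearCl.
  by rewrite (@tprod_funZl2 c%:P c%:P%:P) // => x y; apply: sesquilinearCl.
case: s1 s2 => [_ p1X _] [_ p2X _].
by rewrite (tprod_funZl _ _ _ _ p1X) (tprod_funZl2 _ _ _ _ p2X).
Qed.

Lemma tprod_fun_balancedr a1 a2 : balanced (fun b1 b2 => tprod_fun a1 a2 b1 b2).
Proof.
apply: balanced_poly => [|c a b|a b]; first exact: tprod_funDr.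
  rewrite (@tprod_funZr c%:P c%:P%:P) => [|x y]; last exact: sesquilinearCr.
  by rewrite (@tprod_funZr2 c%:P c%:P%:P) // => x y; apply: sesquilinearCr.
case: s1 s2 => [_ _ p1X] [_ _ p2X].
by rewrite (tprod_funZr _ _ _ _ p1X) (tprod_funZr2 _ _ _ _ p2X).
Qed.

Lemma tprod_balanced u :
  balanced (fun b1 b2 => tensor_lift (fun a1 a2 => tprod_fun a1 a2 b1 b2) u).
Proof.
pose g b1 b2 := tensor_lift (fun a1 a2 => tprod_fun a1 a2 b1 b2).
apply: (@balanced_param _ _ _ _ _ _ g tprod_fun) => [b1 b2|b1 b2 a1 a2|].
- exact: (tensor_liftD (tprod_fun_balancedl b1 b2)).
- exact: (tensor_lift_tens (tprod_fun_balancedl b1 b2)).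
exact: tprod_fun_balancedr.
Qed.

Lemma tprod_pure u b1 b2 : tprod u (b1 ⊗ b2) =
  tensor_lift (fun a1 a2 => tprod_fun a1 a2 b1 b2) u.
Proof. exact: (tensor_lift_tens (tprod_balanced u)). Qed.

Lemma tprodE a1 a2 b1 b2 : tprod (a1 ⊗ a2) (b1 ⊗ b2) = tprod_fun a1 a2 b1 b2.
Proof.
by rewrite tprod_pure (tensor_lift_tens (tprod_fun_balancedl b1 b2)).
Qed.

Lemma tprod_biadd : biadd tprod.
Proof.
apply: tensor_biadd => [u|b1 b2 u v].
  exact: (tensor_liftD (tprod_balanced u)).
rewrite !tprod_pure; exact: (tensor_liftD (tprod_fun_balancedl b1 b2)).
Qed.

(** A scalar on a pure tensor may be placed on its first component, so the rule for [p1] alone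
    determines the rule for the tensor product. *)
Lemma tprodZl c t u v : (forall a b, p1 (c *: a) b = t *: p1 a b) ->
  tprod (c *: u) v = t *: tprod u v.
Proof.
have [Dl Dr] := tprod_biadd; move=> p1Z.
pose o u v := tprod (c *: u) v; pose o' u v := t *: tprod u v.
apply: (@tensor_biext _ _ _ _ o o') => [||a1 a2 b1 b2].
- by split=> [y x x'|x y y']; rewrite /o ?scalerDr (Dl, Dr).
- by split=> [y x x'|x y y']; rewrite /o' (Dl, Dr) scalerDr.
by rewrite /o /o' -tensZl !tprodE; apply: tprod_funZl.
Qed.

Lemma tprodZr c t u v : (forall a b, p1 a (c *: b) = t *: p1 a b) ->
  tprod u (c *: v) = t *: tprod u v.
Proof.
have [Dl Dr] := tprod_biadd; move=> p1Z.
pose o u v := tprod u (c *: v); pose o' u v := t *: tprod u v.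
apply: (@tensor_biext _ _ _ _ o o') => [||a1 a2 b1 b2].
- by split=> [y x x'|x y y']; rewrite /o ?scalerDr (Dl, Dr).
- by split=> [y x x'|x y y']; rewrite /o' (Dl, Dr) scalerDr.
by rewrite /o /o' -tensZl !tprodE; apply: tprod_funZr.
Qed.

Lemma tprod_sesquilinear : sesquilinear tprod.
Proof.
apply: sesquilinearI => [|c u v|c u v|u v|u v]; first exact: tprod_biadd.
- by apply: tprodZl => a b; apply: sesquilinearCl.
- by apply: tprodZr => a b; apply: sesquilinearCr.
- by apply: tprodZl => a b; case: s1.
- by apply: tprodZr => a b; case: s1.
Qed.

Lemma tprod_hom i j a1 a2 b1 b2 : G2 i a2 -> G1 j b1 ->
  tprod (a1 ⊗ a2) (b1 ⊗ b2) =
  (-1) ^+ (i && j) *: modpoly_tens (p1 a1 b1) (p2 a2 b2).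
Proof.
move=> Ga Gb; rewrite tprodE /tprod_fun.
have p10 : p1 a1 0 = 0 by apply: (morphD0 ((sesquilinear_biadd s1).2 a1)).
have p20 : p2 0 b2 = 0 by apply: (morphD0 ((sesquilinear_biadd s2).1 b2)).
have T0l q : modpoly_tens 0 q = 0 :> modpoly (tensor L1 L2) by apply: (morphD0 (TDl q)).
have T0r p : modpoly_tens p 0 = 0 :> modpoly (tensor L1 L2) by apply: (morphD0 (TDr p)).
(* For homogeneous [a2] and [b1] all projections but one vanish, so a single summand is left in each
   sum. *)
rewrite (bigD1 i) //= [X in _ + X]big1 ?addr0 => [|i' i'i]; last first.
  apply: big1 => j' _; rewrite (homproj_id pG2 _ Ga) eq_sym (negPf i'i).
  by rewrite p20 T0r scaler0.
rewrite (bigD1 j) //= [X in _ + X]big1 ?addr0 => [|j' j'j]; last first.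
  rewrite (homproj_id pG1 _ Gb) eq_sym (negPf j'j).
  by rewrite p10 T0l scaler0.
by rewrite (homproj_id pG1 _ Gb) (homproj_id pG2 _ Ga) !eqxx.
Qed.

End TensorProduct.

(** * Iterated products *)

Section Iterated.
Variables (C : fieldType) (A : lmodType {poly C}).
Implicit Types (o : lprod A) (x y : {poly {poly {poly C}}}).

Lemma subst2D x : {morph (@subst2 C A x) : p q / p + q}.
Proof. by apply: modpoly_substD => u v; rewrite /modpolyC !monalgUD. Qed.

Lemma modpolyCCD : {morph (fun v : A => modpolyC (modpolyC v)) : u v / u + v}.
Proof. by move=> u v; rewrite /modpolyC !monalgUD. Qed.

(** Substitution from A[lambda] to A[lambda, mu] with a general coefficient map. Both [compl] and
    [compr] have this form, [f] being the remaining product followed by [subst2]. *)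
Definition subst12 (f : A -> modpoly (modpoly A)) x (p : modpoly A) :
  modpoly (modpoly A) := modpoly_subst f x p.

Lemma subst12D f x : {morph f : u v / u + v} ->
  {morph subst12 f x : p q / p + q}.
Proof. exact: modpoly_substD. Qed.

Lemma subst12U f x n v : {morph f : u v / u + v} ->
  subst12 f x << v *g n >> = x ^+ n *: f v.
Proof. exact: modpoly_substU. Qed.

Lemma subst12_ext f g x p : f =1 g -> subst12 f x p = subst12 g x p.
Proof. by move=> /funext->. Qed.

Lemma subst12_add f g x p :
  subst12 (fun v => f v + g v) x p = subst12 f x p + subst12 g x p.
Proof. exact: modpoly_subst_add. Qed.

Lemma subst12_comp (h : modpoly (modpoly A) -> modpoly (modpoly A)) f x x' p :
  {morph h : u v / u + v} -> (forall u, h (x *: u) = x' *: h u) ->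
  h (subst12 f x p) = subst12 (h \o f) x' p.
Proof. exact: modpoly_subst_comp. Qed.

Lemma subst12_lam1 f x p : {morph f : u v / u + v} ->
  subst12 f x (lam1 C *: p) = x *: subst12 f x p.
Proof. by move=> fD; apply: (modpoly_substX x fD p). Qed.

Lemma subst12_d1 f x y p : {morph f : u v / u + v} ->
  (forall v, f ('X *: v) = y *: f v) ->
  subst12 f x (d1 C *: p) = y *: subst12 f x p.
Proof. by move=> fD; apply: (modpoly_substC x fD p). Qed.

Lemma subst2X x (p : modpoly A) : subst2 x (lam1 C *: p) = x *: subst2 x p.
Proof. exact: (subst12_lam1 _ _ modpolyCCD). Qed.

Lemma complE o1 o2 a x b y c :
  compl o1 o2 a x b y c = subst12 (fun v => subst2 y (o2 v c)) x (o1 a b).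
Proof. exact: erefl. Qed.

Lemma comprE o1 o2 a x b y c :
  compr o1 o2 a x b y c = subst12 (fun v => subst2 x (o1 a v)) y (o2 b c).
Proof. exact: erefl. Qed.

Lemma compl_iotaD o y c : biadd o -> {morph (fun v => subst2 y (o v c)) : u v / u + v}.
Proof. by move=> [oD _] u v; rewrite oD subst2D. Qed.

Lemma compr_iotaD o x a : biadd o -> {morph (fun v => subst2 x (o a v)) : u v / u + v}.
Proof. by move=> [_ oD] u v; rewrite oD subst2D. Qed.

Definition triadd (W : zmodType) (F : A -> A -> A -> W) :=
  [/\ forall b c, {morph (fun a => F a b c) : u v / u + v},
      forall a c, {morph (fun b => F a b c) : u v / u + v}
    & forall a b, {morph F a b : u v / u + v}].

Lemma compl_triadd o1 o2 x y : biadd o1 -> biadd o2 ->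
  triadd (fun a b c => compl o1 o2 a x b y c).
Proof.
move=> o1D o2D; split=> [b c u v|a c u v|a b u v]; rewrite !complE.
- by rewrite o1D.1 (subst12D _ (compl_iotaD _ _ o2D)).
- by rewrite o1D.2 (subst12D _ (compl_iotaD _ _ o2D)).
rewrite -subst12_add; apply: subst12_ext => w.
by rewrite o2D.2 subst2D.
Qed.

Lemma compr_triadd o1 o2 x y : biadd o1 -> biadd o2 ->
  triadd (fun a b c => compr o1 o2 a x b y c).
Proof.
move=> o1D o2D; split=> [b c u v|a c u v|a b u v]; rewrite !comprE.
- rewrite -subst12_add; apply: subst12_ext => w.
  by rewrite o1D.1 subst2D.
- by rewrite o2D.1 (subst12D _ (compr_iotaD _ _ o1D)).
- by rewrite o2D.2 (subst12D _ (compr_iotaD _ _ o1D)).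
Qed.

Definition lprod_add o o' : lprod A := fun a b => o a b + o' a b.

Lemma compl_addl o1 o1' o2 a x b y c : biadd o2 ->
  compl (lprod_add o1 o1') o2 a x b y c =
  compl o1 o2 a x b y c + compl o1' o2 a x b y c.
Proof. by move=> o2D; rewrite !complE (subst12D _ (compl_iotaD _ _ o2D)). Qed.

Lemma compl_addr o1 o2 o2' a x b y c :
  compl o1 (lprod_add o2 o2') a x b y c =
  compl o1 o2 a x b y c + compl o1 o2' a x b y c.
Proof.
rewrite !complE -subst12_add; apply: subst12_ext => w.
by rewrite subst2D.
Qed.

Lemma compr_addl o1 o1' o2 a x b y c :
  compr (lprod_add o1 o1') o2 a x b y c =
  compr o1 o2 a x b y c + compr o1' o2 a x b y c.
Proof.
rewrite !comprE -subst12_add; apply: subst12_ext => w.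
by rewrite subst2D.
Qed.

Lemma compr_addr o1 o2 o2' a x b y c : biadd o1 ->
  compr o1 (lprod_add o2 o2') a x b y c =
  compr o1 o2 a x b y c + compr o1 o2' a x b y c.
Proof. by move=> o1D; rewrite !comprE (subst12D _ (compr_iotaD _ _ o1D)). Qed.

Lemma lprod_add_biadd o o' : biadd o -> biadd o' -> biadd (lprod_add o o').
Proof.
by move=> [Dl Dr] [Dl' Dr']; split=> [v x y|u x y];
  rewrite /lprod_add (Dl, Dr) (Dl', Dr') addrACA.
Qed.

Lemma lprod_add_sesquilinear o o' : sesquilinear o -> sesquilinear o' ->
  sesquilinear (lprod_add o o').
Proof.
move=> so so'; case: (so) (so') => _ oXl oXr [_ oXl' oXr'].
apply: sesquilinearI => [|c a b|c a b|a b|a b]; rewrite /lprod_add ?scalerDr.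
- by apply: lprod_add_biadd; apply: sesquilinear_biadd.
- by rewrite !sesquilinearCl.
- by rewrite !sesquilinearCr.
- by rewrite oXl oXl'.
- by rewrite oXr oXr'.
Qed.

Definition graded_lprod (G : bool -> A -> Prop) o :=
  forall i j a b n, G i a -> G j b -> G (i (+) j) (o a b)@_n.

Lemma lprod_add_graded G o o' : Z2_graded G ->
  graded_lprod G o -> graded_lprod G o' -> graded_lprod G (lprod_add o o').
Proof.
move=> gr go go' i j a b n Ga Gb; rewrite /lprod_add mcoeffD.
by apply: Z2_gradedD => //; [apply: go | apply: go'].
Qed.

Lemma conformalI G o : Z2_graded G -> sesquilinear o -> graded_lprod G o ->
  conformal_superalgebra G o.
Proof. by move=> gr [? ? ?] go. Qed.

(** A change of variables that fixes the coefficients in A acts on iterated products through their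
    two variables. *)
Lemma comp_rename (h : modpoly (modpoly A) -> modpoly (modpoly A)) x x' y y'
    o1 o2 a b c :
  {morph h : u v / u + v} ->
  (forall v, h (modpolyC (modpolyC v)) = modpolyC (modpolyC v)) ->
  (forall u, h (x *: u) = x' *: h u) -> (forall u, h (y *: u) = y' *: h u) ->
  h (compl o1 o2 a x b y c) = compl o1 o2 a x' b y' c /\
  h (compr o1 o2 a x b y c) = compr o1 o2 a x' b y' c.
Proof.
move=> hD hC hx hy.
have hsubst z z' p : (forall u, h (z *: u) = z' *: h u) ->
    h (subst2 z p) = subst2 z' p.
  move=> hz; rewrite -[subst2 z p]/(subst12 (fun v => modpolyC (modpolyC v)) z p).
  rewrite (subst12_comp _ _ hD hz).
  by apply: subst12_ext.
rewrite !complE !comprE (subst12_comp _ _ hD hx) (subst12_comp _ _ hD hy).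
by split; apply: subst12_ext => v /=; apply: hsubst.
Qed.

(* [assoc_pair] constrains only a o_lambda (b o_mu c), whereas left-symmetry   *)
(* also involves b o_mu (a o_lambda c).                                       *)
Definition exchange (P : modpoly (modpoly A)) : modpoly (modpoly A) :=
  modpoly_subst (subst2 (mu C)) (lam C) P.

Lemma exchangeD : {morph exchange : P Q / P + Q}.
Proof. by apply: modpoly_substD; apply: subst2D. Qed.

Lemma exchange_mu P : exchange (mu C *: P) = lam C *: exchange P.
Proof. by apply: modpoly_substX; apply: subst2D. Qed.

Lemma exchange_lam P : exchange (lam C *: P) = mu C *: exchange P.
Proof.
apply: modpoly_substC; first exact: subst2D.
by move=> v; apply: modpoly_substX; apply: modpolyCCD.
Qed.

Lemma exchangeC v : exchange (modpolyC (modpolyC v)) = modpolyC (modpolyC v).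
Proof.
rewrite /exchange [modpolyC (modpolyC v) in LHS]/modpolyC.
rewrite (modpoly_substU _ _ _ (@subst2D _)) expr0 scale1r.
by rewrite /subst2 (modpoly_substU _ _ _ modpolyCCD) expr0 scale1r.
Qed.

Lemma exchange_lam_mu P : exchange ((lam C + mu C) *: P) = (lam C + mu C) *: exchange P.
Proof. by rewrite !scalerDl exchangeD exchange_lam exchange_mu addrC. Qed.

(** The common shape of associativity of circ and of the identity (a circ b) star c = a circ (b star
    c). *)
Definition assoc_pair o1 o2 := forall a b c,
  compl o1 o2 a (lam C) b (lam C + mu C) c = compr o1 o2 a (lam C) b (mu C) c.

Lemma assoc_pair_exchange o1 o2 a b c : assoc_pair o1 o2 ->
  compl o1 o2 a (mu C) b (lam C + mu C) c = compr o1 o2 a (mu C) b (lam C) c.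
Proof.
move=> /(_ a b c) E.
have rn := comp_rename o1 o2 a b c exchangeD exchangeC exchange_lam.
by have [<- _] := rn _ _ exchange_lam_mu; rewrite E; have [_ ->] := rn _ _ exchange_mu.
Qed.

(* Since the derivation acts as [- y] under [_ o_y c], substituting            *)
(* [- d - lambda] for [lambda] and then [x] for [lambda] yields [y - x].       *)
Lemma compl_comm (G : bool -> A -> Prop) o1 o2 i j a b x y c :
  sesquilinear o2 -> commutative_conf G o1 -> G i a -> G j b ->
  compl o1 o2 a x b y c = (-1) ^+ (i && j) *: compl o1 o2 b (y - x) a y c.
Proof.
move=> so2 com Ga Gb; have o2D := sesquilinear_biadd so2.
have iD := compl_iotaD y c o2D.
rewrite !complE (com _ _ _ _ Ga Gb) morphD_sign; last exact: subst12D.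
suff -> : subst12 (fun v => subst2 y (o2 v c)) x (subst1 (- d1 C - lam1 C) (o1 b a)) =
    subst12 (fun v => subst2 y (o2 v c)) (y - x) (o1 b a) by [].
pose h := subst12 (fun v => subst2 y (o2 v c)) x.
have hD : {morph h : p q / p + q} by apply: subst12D.
have hl p : h ((- d1 C - lam1 C) *: p) = (y - x) *: h p.
  rewrite !scalerBl !scaleNr (morphDB hD) (morphDN hD) /h.
  rewrite subst12_lam1 // (@subst12_d1 _ _ (- y)) // ?scaleNr ?opprK //.
  by case: so2 => _ o2X _ v; rewrite o2X scaleNr (morphDN (@subst2D y)) scaleNr subst2X.
rewrite [LHS](modpoly_subst_comp _ _ hD hl).
by apply: subst12_ext => v; rewrite /= /h subst12U // expr0 scale1r.
Qed.

Definition symm_pair (G : bool -> A -> Prop) o1 o2 :=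
  forall i j a b c, G i a -> G j b ->
  compl o1 o2 a (lam C) b (lam C + mu C) c =
  (-1) ^+ (i && j) *: compl o1 o2 b (mu C) a (lam C + mu C) c.

(** The case x = lambda, y = lambda + mu of [compl_comm], where y - x = mu. *)
Lemma commutative_symm_pair (G : bool -> A -> Prop) o1 o2 :
  sesquilinear o2 -> commutative_conf G o1 -> symm_pair G o1 o2.
Proof.
move=> so2 com i j a b c Ga Gb.
by rewrite (compl_comm _ _ _ so2 com Ga Gb) addrAC subrr add0r.
Qed.

End Iterated.

(** * The identities on the tensor product *)

Section BilinLeftSym.
Variables (S : comNzRingType) (M1 M2 M : lmodType S).
Implicit Types (e s : S).

(** Since R = RQ, the left side is e T(P - Q, R), and similarly on the right. The signs s1 and s2 of
    the two factors multiply, and the last hypothesis matches them with the Koszul signs e, e' and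
    the total sign s. *)
Lemma bilin_left_sym1 (T : M1 -> M2 -> M) e e' s s1 s2 P P' Q Q' R RQ R' RQ' :
  bilin T -> P - Q = s1 *: (P' - Q') -> R = s2 *: R' -> R = RQ -> R' = RQ' ->
  e * (s1 * s2) = s * e' ->
  e *: T P R - e *: T Q RQ = s *: (e' *: T P' R' - e' *: T Q' RQ').
Proof.
move=> linT PQ RR' <- <- es; rewrite -!scalerBr -!(morphDB (bilinDl linT _)) PQ RR'.
by rewrite (bilinZl linT) (bilinZr linT) !scalerA -es !mulrA.
Qed.

Lemma bilin_left_sym2 (T : M2 -> M1 -> M) e e' s s1 s2 P P' Q Q' R RQ R' RQ' :
  bilin T -> P - Q = s1 *: (P' - Q') -> R = s2 *: R' -> R = RQ -> R' = RQ' ->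
  e * (s1 * s2) = s * e' ->
  e *: T R P - e *: T RQ Q = s *: (e' *: T R' P' - e' *: T RQ' Q').
Proof.
move=> linT PQ RR' <- <- es; rewrite -!scalerBr -!(morphDB (bilinDr linT _)) PQ RR'.
by rewrite (bilinZr linT) (bilinZl linT) !scalerA -es !mulrA.
Qed.

End BilinLeftSym.

Section TensorIdentities.
Variables (C : fieldType) (L1 L2 : lmodType {poly C}).
Variables (G1 : bool -> L1 -> Prop) (G2 : bool -> L2 -> Prop).

Local Notation L := (tensor L1 L2).
Local Notation GT := (tensor_grading G1 G2).

Definition tens2 : modpoly (modpoly L1) -> modpoly (modpoly L2) ->
  modpoly (modpoly L) := modpoly_lift (@modpoly_tens C L1 L2).

Lemma tens2_bilin : bilin tens2.
Proof. exact: (modpoly_lift_bilin (modpoly_tens_bilin L1 L2)). Qed.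

Lemma subst12_tens (f : L -> modpoly (modpoly L)) g h x e p q :
  {morph f : u v / u + v} ->
  (forall m n, f (p@_m ⊗ q@_n) = e *: tens2 (g p@_m) (h q@_n)) ->
  subst12 f x (modpoly_tens p q) = e *: tens2 (subst12 g x p) (subst12 h x q).
Proof. by move=> fD fE; apply: (modpoly_subst_lift x tens2_bilin fD fE). Qed.

Lemma tens2C v w :
  tens2 (modpolyC (modpolyC v)) (modpolyC (modpolyC w)) = modpolyC (modpolyC (v ⊗ w)).
Proof.
rewrite /tens2 (modpoly_liftUU (modpoly_tens_bilin L1 L2)).
by rewrite [modpoly_tens _ _](modpoly_liftUU (tens_bilin L1 L2)).
Qed.

Lemma subst2_tens x (p : modpoly L1) (q : modpoly L2) :
  subst2 x (modpoly_tens p q) = tens2 (subst2 x p) (subst2 x q).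
Proof.
rewrite -[RHS]scale1r; apply: subst12_tens; first exact: modpolyCCD.
by move=> m n; rewrite scale1r tens2C.
Qed.

(** On tensors of polynomials an element of C[d][lambda], such as -d - lambda, may act through
    either factor, so its power of exponent m + n is shared between the two. *)
Lemma subst1_tens x (p : modpoly L1) (q : modpoly L2) :
  subst1 x (modpoly_tens p q) = modpoly_tens (subst1 x p) (subst1 x q).
Proof.
rewrite -[RHS]scale1r.
apply: (modpoly_subst_lift x (modpoly_tens_bilin L1 L2)) => [u v|m n].
  exact: monalgUD.
by rewrite scale1r [modpoly_tens _ _](modpoly_liftUU (tens_bilin L1 L2)).
Qed.

(** What the identities use of the tensor product: biadditivity and its values on homogeneous pure
    tensors. The chosen projections are forgotten. *)
Definition is_tprod (p1 : lprod L1) (p2 : lprod L2) (o : lprod L) :=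
  biadd o /\ forall i j a1 a2 b1 b2, G2 i a2 -> G1 j b1 ->
    o (a1 ⊗ a2) (b1 ⊗ b2) = (-1) ^+ (i && j) *: modpoly_tens (p1 a1 b1) (p2 a2 b2).

(** The first product contributes |a2||b1|. The coefficients of the product of [a2] and [b2] have
    parity |a2| + |b2|, by [graded_lprod G2 p2], so the second contributes (|a2| + |b2|)|c1|. *)
Lemma compl_tprod p1 p2 q1 q2 o o' i2 j1 j2 k1 a1 a2 b1 b2 c1 c2 x y :
  is_tprod p1 p2 o -> is_tprod q1 q2 o' -> graded_lprod G2 p2 ->
  G2 i2 a2 -> G1 j1 b1 -> G2 j2 b2 -> G1 k1 c1 ->
  compl o o' (a1 ⊗ a2) x (b1 ⊗ b2) y (c1 ⊗ c2) =
  (-1) ^+ ((i2 && j1) (+) ((i2 (+) j2) && k1)) *: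
    tens2 (compl p1 q1 a1 x b1 y c1) (compl p2 q2 a2 x b2 y c2).
Proof.
move=> [_ oE] [oD' oE'] gp2 Ga Gb1 Gb2 Gc; have fD := compl_iotaD y (c1 ⊗ c2) oD'.
rewrite !complE (oE _ _ _ _ _ _ Ga Gb1) (morphD_sign _ _ (subst12D _ fD)).
rewrite signr_addb -scalerA.
suff <- : subst12 (fun v => subst2 y (o' v (c1 ⊗ c2))) x
    (modpoly_tens (p1 a1 b1) (p2 a2 b2)) =
  (-1) ^+ ((i2 (+) j2) && k1) *:
    tens2 (subst12 (fun v => subst2 y (q1 v c1)) x (p1 a1 b1))
    (subst12 (fun v => subst2 y (q2 v c2)) x (p2 a2 b2)) by [].
apply: subst12_tens => // m n.
rewrite (oE' _ _ _ _ _ _ (gp2 _ _ _ _ _ Ga Gb2) Gc).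
by rewrite (morphD_sign _ _ (@subst2D _ _ y)) subst2_tens.
Qed.

Lemma compr_tprod p1 p2 q1 q2 o o' i2 j1 j2 k1 a1 a2 b1 b2 c1 c2 x y :
  is_tprod p1 p2 o -> is_tprod q1 q2 o' -> graded_lprod G1 q1 ->
  G2 i2 a2 -> G1 j1 b1 -> G2 j2 b2 -> G1 k1 c1 ->
  compr o o' (a1 ⊗ a2) x (b1 ⊗ b2) y (c1 ⊗ c2) =
  (-1) ^+ ((i2 && j1) (+) ((i2 (+) j2) && k1)) *:
    tens2 (compr p1 q1 a1 x b1 y c1) (compr p2 q2 a2 x b2 y c2).
Proof.
move=> [oD oE] [_ oE'] gq1 Ga Gb1 Gb2 Gc; have fD := compr_iotaD x (a1 ⊗ a2) oD.
rewrite !comprE (oE' _ _ _ _ _ _ Gb2 Gc) (morphD_sign _ _ (subst12D _ fD)).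
(* Here the signs arise as |b2||c1| and |a2|(|b1| + |c1|), with the same total as in the other
   bracketing. *)
have -> : (i2 && j1) (+) ((i2 (+) j2) && k1) = (j2 && k1) (+) (i2 && (j1 (+) k1)).
  by case: i2 j1 j2 k1 {Ga Gb1 Gb2 Gc} => [] [] [] [].
rewrite signr_addb -scalerA.
suff <- : subst12 (fun v => subst2 x (o (a1 ⊗ a2) v)) y
    (modpoly_tens (q1 b1 c1) (q2 b2 c2)) =
  (-1) ^+ (i2 && (j1 (+) k1)) *:
    tens2 (subst12 (fun v => subst2 x (p1 a1 v)) y (q1 b1 c1))
    (subst12 (fun v => subst2 x (p2 a2 v)) y (q2 b2 c2)) by [].
apply: subst12_tens => // m n.
rewrite (oE _ _ _ _ _ _ Ga (gq1 _ _ _ _ _ Gb1 Gc)).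
by rewrite (morphD_sign _ _ (@subst2D _ _ x)) subst2_tens.
Qed.

Hypotheses (gr1 : Z2_graded G1) (gr2 : Z2_graded G2).

Lemma modpoly_tens_graded i j (p : modpoly L1) (q : modpoly L2) n :
  (forall m, G1 i p@_m) -> (forall m, G2 j q@_m) ->
  GT (i (+) j) (modpoly_tens p q)@_n.
Proof.
move=> Gp Gq; rewrite (morphD_sum _ _ (@mcoeff_is_morphD _ n)).
elim/big_ind: _ => [|u v|l _]; [exact: tensor_grading0 | exact: tensor_gradingD |].
rewrite (morphD_sum _ _ (@mcoeff_is_morphD _ n)).
elim/big_ind: _ => [|u v|m _]; [exact: tensor_grading0 | exact: tensor_gradingD |].
rewrite mcoeffU; case: eqP => _; last exact: tensor_grading0.
exact: tensor_grading_tens.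
Qed.

Lemma tprod_graded p1 p2 o : is_tprod p1 p2 o ->
  graded_lprod G1 p1 -> graded_lprod G2 p2 -> graded_lprod GT o.
Proof.
move=> [[oDl oDr] oE] gp1 gp2 i j u v n Gu Gv.
elim/tensor_grading_ind: Gu => {u} [|u u' IHu IHu'|i1 i2 a1 a2 Ga1 Ga2 <-].
- by rewrite (morphD0 (oDl v)) mcoeff0; apply: tensor_grading0.
- by rewrite oDl mcoeffD; apply: tensor_gradingD.
elim/tensor_grading_ind: Gv => {v} [|u u' IHu IHu'|j1 j2 b1 b2 Gb1 Gb2 <-].
- by rewrite (morphD0 (oDr _)) mcoeff0; apply: tensor_grading0.
- by rewrite oDr mcoeffD; apply: tensor_gradingD.
rewrite (oE _ _ _ _ _ _ Ga2 Gb1).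
rewrite (morphD_sign (S' := {poly C}) (W := L) _ _ (@mcoeff_is_morphD _ n)).
apply: tensor_gradingZ => //; rewrite addbACA; apply: modpoly_tens_graded => m.
  exact: gp1.
exact: gp2.
Qed.

Lemma tensor_triext (W : zmodType) (F F' : L -> L -> L -> W) k l :
  triadd F -> triadd F' ->
  (forall i1 i2 j1 j2 k1 k2 a1 a2 b1 b2 c1 c2, G1 i1 a1 -> G2 i2 a2 ->
     G1 j1 b1 -> G2 j2 b2 -> G1 k1 c1 -> G2 k2 c2 -> i1 (+) i2 = k -> j1 (+) j2 = l ->
     F (a1 ⊗ a2) (b1 ⊗ b2) (c1 ⊗ c2) = F' (a1 ⊗ a2) (b1 ⊗ b2) (c1 ⊗ c2)) ->
  forall u v w, GT k u -> GT l v -> F u v w = F' u v w.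
Proof.
move=> [Fa Fb Fc] [Fa' Fb' Fc'] FF' u v w Gu Gv.
elim/tensor_grading_ind: Gu => {u} [|u u' IHu IHu'|i1 i2 a1 a2 Ga1 Ga2 ia].
- by rewrite (morphD0 (Fa v w)) (morphD0 (Fa' v w)).
- by rewrite Fa Fa' IHu IHu'.
elim/tensor_grading_ind: Gv => {v} [|v v' IHv IHv'|j1 j2 b1 b2 Gb1 Gb2 jb].
- by rewrite (morphD0 (Fb _ w)) (morphD0 (Fb' _ w)).
- by rewrite Fb Fb' IHv IHv'.
(* No parity is prescribed for the third argument, so it is split into its even and odd parts. *)
have [[w0 w1] [[/= Gw0 Gw1 wE] _]] := Z2_graded_direct (tensor_Z2_graded gr1 gr2) w.
have Ew0 u0 m : GT m u0 -> F (a1 ⊗ a2) (b1 ⊗ b2) u0 = F' (a1 ⊗ a2) (b1 ⊗ b2) u0.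
  elim/tensor_grading_ind => {u0} [|u0 w' IHw IHw'|k1 k2 c1 c2 Gc1 Gc2 _].
  - by rewrite (morphD0 (Fc _ _)) (morphD0 (Fc' _ _)).
  - by rewrite Fc Fc' IHw IHw'.
  exact: (FF' i1 i2 j1 j2 k1 k2).
by rewrite wE Fc Fc' (Ew0 _ _ Gw0) (Ew0 _ _ Gw1).
Qed.

Lemma tensor_triext_all (W : zmodType) (F F' : L -> L -> L -> W) :
  triadd F -> triadd F' ->
  (forall i1 i2 j1 j2 k1 k2 a1 a2 b1 b2 c1 c2, G1 i1 a1 -> G2 i2 a2 ->
     G1 j1 b1 -> G2 j2 b2 -> G1 k1 c1 -> G2 k2 c2 ->
     F (a1 ⊗ a2) (b1 ⊗ b2) (c1 ⊗ c2) = F' (a1 ⊗ a2) (b1 ⊗ b2) (c1 ⊗ c2)) ->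
  forall u v w, F u v w = F' u v w.
Proof.
move=> tF tF' FF' u v w.
have E k l u0 v0 : GT k u0 -> GT l v0 -> F u0 v0 w = F' u0 v0 w.
  by apply: tensor_triext => // *; apply: FF'; eassumption.
case: tF tF' => [Fa Fb _] [Fa' Fb' _].
have [[u0 u1] [[/= Gu0 Gu1 ->] _]] := Z2_graded_direct (tensor_Z2_graded gr1 gr2) u.
have [[v0 v1] [[/= Gv0 Gv1 ->] _]] := Z2_graded_direct (tensor_Z2_graded gr1 gr2) v.
rewrite !Fa !Fb !Fa' !Fb'.
rewrite (E _ _ _ _ Gu0 Gv0) (E _ _ _ _ Gu0 Gv1).
by rewrite (E _ _ _ _ Gu1 Gv0) (E _ _ _ _ Gu1 Gv1).
Qed.

Lemma tensor_biext_graded (W : zmodType) (o o' : L -> L -> W) :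
  biadd o -> biadd o' ->
  (forall i j a1 a2 b1 b2, G2 i a2 -> G1 j b1 ->
    o (a1 ⊗ a2) (b1 ⊗ b2) = o' (a1 ⊗ a2) (b1 ⊗ b2)) ->
  forall u v, o u v = o' u v.
Proof.
move=> oD oD' oo'; apply: tensor_biext => // a1 a2 b1 b2.
case: oD oD' => [Dl Dr] [Dl' Dr'].
have [[x y] [[/= Gx Gy ->] _]] := Z2_graded_direct gr2 a2.
have [[z t] [[/= Gz Gt ->] _]] := Z2_graded_direct gr1 b1.
rewrite tensDr tensDl !Dl !Dr !Dl' !Dr'.
rewrite (oo' _ _ _ _ _ _ Gx Gz) (oo' _ _ _ _ _ _ Gx Gt).
by rewrite (oo' _ _ _ _ _ _ Gy Gz) (oo' _ _ _ _ _ _ Gy Gt).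
Qed.

Section Pair.
Variables (p1 q1 : lprod L1) (p2 q2 : lprod L2) (o o' : lprod L).
Hypotheses (oT : is_tprod p1 p2 o) (oT' : is_tprod q1 q2 o').
Hypotheses (gq1 : graded_lprod G1 q1) (gp2 : graded_lprod G2 p2).

Let oD : biadd o := oT.1.
Let oD' : biadd o' := oT'.1.

Lemma tprod_assoc_pair : assoc_pair p1 q1 -> assoc_pair p2 q2 -> assoc_pair o o'.
Proof.
move=> as1 as2.
apply: (tensor_triext_all (compl_triadd _ _ oD oD') (compr_triadd _ _ oD oD')).
move=> i1 i2 j1 j2 k1 k2 a1 a2 b1 b2 c1 c2 _ Ga Gb1 Gb2 Gc _.
rewrite (compl_tprod _ _ _ _ oT oT' gp2 Ga Gb1 Gb2 Gc).
by rewrite (compr_tprod _ _ _ _ oT oT' gq1 Ga Gb1 Gb2 Gc) as1 as2.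
Qed.

Lemma triadd_left_sym k l :
  triadd (fun u v w => compl o o' u (lam C) v (lam C + mu C) w -
                       compr o o' u (lam C) v (mu C) w) /\
  triadd (fun u v w => (-1) ^+ (k && l) *:
            (compl o o' v (mu C) u (lam C + mu C) w - compr o o' v (mu C) u (lam C) w)).
Proof.
have [la lb lc] := compl_triadd (lam C) (lam C + mu C) oD oD'.
have [ra rb rc] := compr_triadd (lam C) (mu C) oD oD'.
have [la' lb' lc'] := compl_triadd (mu C) (lam C + mu C) oD oD'.
have [ra' rb' rc'] := compr_triadd (mu C) (lam C) oD oD'.
split; split=> a b u v.
- by rewrite la ra opprD addrACA.
- by rewrite lb rb opprD addrACA.
- by rewrite lc rc opprD addrACA.
- by rewrite lb' rb' opprD addrACA scalerDr.
- by rewrite la' ra' opprD addrACA scalerDr.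
- by rewrite lc' rc' opprD addrACA scalerDr.
Qed.

(** Left-symmetry comes from the first factor. In the second the two bracketings coincide, also
    after exchanging the arguments ([assoc_pair_exchange]), and are supersymmetric.
    [tprod_left_sym2] is the mirror case. *)
Lemma tprod_left_sym1 :
  left_sym_conf G1 p1 q1 -> assoc_pair p2 q2 -> symm_pair G2 p2 q2 ->
  left_sym_conf GT o o'.
Proof.
move=> ls1 as2 sy2 k l u v w Gu Gv; have [tF tF'] := triadd_left_sym k l.
apply: (tensor_triext tF tF' _ _ Gu Gv).
move=> i1 i2 j1 j2 k1 k2 a1 a2 b1 b2 c1 c2 Ga1 Ga2 Gb1 Gb2 Gc1 Gc2 <- <-.
rewrite !(compl_tprod _ _ _ _ oT oT' gp2 Ga2 Gb1 Gb2 Gc1).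
rewrite !(compr_tprod _ _ _ _ oT oT' gq1 Ga2 Gb1 Gb2 Gc1).
rewrite !(compl_tprod _ _ _ _ oT oT' gp2 Gb2 Ga1 Ga2 Gc1).
rewrite !(compr_tprod _ _ _ _ oT oT' gq1 Gb2 Ga1 Ga2 Gc1).
apply: (bilin_left_sym1 tens2_bilin (ls1 _ _ _ _ c1 Ga1 Gb1) (sy2 _ _ _ _ c2 Ga2 Gb2)
  (as2 _ _ _) (assoc_pair_exchange _ _ _ as2)).
(* The terms in |c1| cancel. What remains is |a2||b1| + |a1||b1| + |a2||b2| = (|a1| + |a2|)(|b1| +
   |b2|) + |b2||a1| modulo 2. *)
rewrite -!signr_addb; congr (_ ^+ nat_of_bool _).
by case: i1 i2 j1 j2 k1 {Ga1 Ga2 Gb1 Gb2 Gc1} => [] [] [] [] [].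
Qed.

Lemma tprod_left_sym2 :
  left_sym_conf G2 p2 q2 -> assoc_pair p1 q1 -> symm_pair G1 p1 q1 ->
  left_sym_conf GT o o'.
Proof.
move=> ls2 as1 sy1 k l u v w Gu Gv; have [tF tF'] := triadd_left_sym k l.
apply: (tensor_triext tF tF' _ _ Gu Gv).
move=> i1 i2 j1 j2 k1 k2 a1 a2 b1 b2 c1 c2 Ga1 Ga2 Gb1 Gb2 Gc1 Gc2 <- <-.
rewrite !(compl_tprod _ _ _ _ oT oT' gp2 Ga2 Gb1 Gb2 Gc1).
rewrite !(compr_tprod _ _ _ _ oT oT' gq1 Ga2 Gb1 Gb2 Gc1).
rewrite !(compl_tprod _ _ _ _ oT oT' gp2 Gb2 Ga1 Ga2 Gc1).
rewrite !(compr_tprod _ _ _ _ oT oT' gq1 Gb2 Ga1 Ga2 Gc1).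
apply: (bilin_left_sym2 tens2_bilin (ls2 _ _ _ _ c2 Ga2 Gb2) (sy1 _ _ _ _ c1 Ga1 Gb1)
  (as1 _ _ _) (assoc_pair_exchange _ _ _ as1)).
rewrite -!signr_addb; congr (_ ^+ nat_of_bool _).
by case: i1 i2 j1 j2 k1 {Ga1 Ga2 Gb1 Gb2 Gc1} => [] [] [] [] [].
Qed.

End Pair.

End TensorIdentities.

(** * Sums of lambda-products, commutativity and assembly *)

Lemma scaled_diffD (S : nzRingType) (M : lmodType S) (s : S) (P Q p q P' Q' p' q' : M) :
  P - Q = s *: (p - q) -> P' - Q' = s *: (p' - q') ->
  (P + P') - (Q + Q') = s *: ((p + p') - (q + q')).
Proof. by move=> E E'; rewrite opprD addrACA E E' -scalerDr addrACA -opprD. Qed.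

Section PairSums.
Variables (C : fieldType) (A : lmodType {poly C}) (G : bool -> A -> Prop).

Lemma assoc_pair_addr (o q q' : lprod A) : biadd o ->
  assoc_pair o q -> assoc_pair o q' -> assoc_pair o (lprod_add q q').
Proof.
by move=> oD as1 as2 a b c; rewrite compl_addr (compr_addr _ _ _ _ _ _ _ oD) as1 as2.
Qed.

Lemma left_sym_addl (o o' q : lprod A) : biadd q ->
  left_sym_conf G o q -> left_sym_conf G o' q -> left_sym_conf G (lprod_add o o') q.
Proof.
move=> qD ls ls' i j a b c Ga Gb.
rewrite !(compl_addl _ _ _ _ _ _ _ qD) !compr_addl.
exact: (scaled_diffD (ls _ _ _ _ c Ga Gb) (ls' _ _ _ _ c Ga Gb)).
Qed.

Lemma left_sym_addr (o q q' : lprod A) : biadd o ->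
  left_sym_conf G o q -> left_sym_conf G o q' -> left_sym_conf G o (lprod_add q q').
Proof.
move=> oD ls ls' i j a b c Ga Gb.
rewrite !compl_addr !(compr_addr _ _ _ _ _ _ _ oD).
exact: (scaled_diffD (ls _ _ _ _ c Ga Gb) (ls' _ _ _ _ c Ga Gb)).
Qed.

End PairSums.

(** Both factors are reversed by the same substitution of -d - lambda, which [subst1_tens] collects
    into one on the tensor product; a sign count remains. *)
Lemma tprod_commutative (C : fieldType) (L1 L2 : lmodType {poly C})
    (G1 : bool -> L1 -> Prop) (G2 : bool -> L2 -> Prop)
    (p1 : lprod L1) (p2 : lprod L2) (o : lprod (tensor L1 L2)) :
  is_tprod G1 G2 p1 p2 o -> commutative_conf G1 p1 -> commutative_conf G2 p2 ->
  commutative_conf (tensor_grading G1 G2) o.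
Proof.
move=> [[oDl oDr] oE] com1 com2 k l u v Gu Gv.
pose S := @subst1 C (tensor L1 L2) (- d1 C - lam1 C).
have SD : {morph S : p q / p + q}.
  by apply: modpoly_substD => x y; apply: monalgUD.
rewrite -[subst1 _ _]/(S (o v u)).
elim/tensor_grading_ind: Gu => {u} [|u u' IHu IHu'|i1 i2 a1 a2 Ga1 Ga2 <-].
- by rewrite (morphD0 (oDl v)) (morphD0 (oDr v)) (morphD0 SD) scaler0.
- by rewrite oDl oDr SD scalerDr IHu IHu'.
elim/tensor_grading_ind: Gv => {v} [|v v' IHv IHv'|j1 j2 b1 b2 Gb1 Gb2 <-].
- by rewrite (morphD0 (oDl _)) (morphD0 (oDr _)) (morphD0 SD) scaler0.
- by rewrite oDl oDr SD scalerDr IHv IHv'.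
rewrite (oE _ _ _ _ _ _ Ga2 Gb1) (oE _ _ _ _ _ _ Gb2 Ga1) (morphD_sign _ _ SD).
rewrite {SD}/S subst1_tens (com1 _ _ _ _ Ga1 Gb1) (com2 _ _ _ _ Ga2 Gb2).
rewrite (bilinZl (modpoly_tens_bilin L1 L2)) (bilinZr (modpoly_tens_bilin L1 L2)).
rewrite !scalerA -!signr_addb -?addbA.
suff -> : (i2 && j1) (+) ((i1 && j1) (+) (i2 && j2)) =
  ((i1 (+) i2) && (j1 (+) j2)) (+) (j2 && i1) by [].
by case: i1 i2 j1 j2 {Ga1 Ga2 Gb1 Gb2} => [] [] [] [].
Qed.

Lemma is_tprod_exists (C : fieldType) (L1 L2 : lmodType {poly C})
    (G1 : bool -> L1 -> Prop) (G2 : bool -> L2 -> Prop)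
    (p1 : lprod L1) (p2 : lprod L2) :
  Z2_graded G1 -> Z2_graded G2 -> sesquilinear p1 -> sesquilinear p2 ->
  exists o, is_tprod G1 G2 p1 p2 o /\ sesquilinear o.
Proof.
move=> /Z2_graded_homproj[pi1 pG1] /Z2_graded_homproj[pi2 pG2] s1 s2.
exists (tprod pi1 pi2 p1 p2); split; last exact: (tprod_sesquilinear pG1 pG2 s1 s2).
split; first exact: (tprod_biadd pG1 pG2 s1 s2).
by move=> i j a1 a2 b1 b2; apply: (tprod_hom pG1 pG2 s1 s2).
Qed.

Theorem theorem4p13 (R : realType) (L1 L2 : lmodType {poly R[i]})
    (G1 : bool -> L1 -> Prop) (circ1 star1 : lprod L1)
    (G2 : bool -> L2 -> Prop) (circ2 star2 : lprod L2) :
  preLie_Poisson_conformal_superalgebra G1 circ1 star1 ->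
  preLie_Poisson_conformal_superalgebra G2 circ2 star2 ->
  exists circ star : lprod (tensor L1 L2),
    unique (tensor_circ_spec G1 G2 circ1 circ2) circ /\
    unique (tensor_star_spec G1 G2 circ1 star1 circ2 star2) star /\
    preLie_Poisson_conformal_superalgebra (tensor_grading G1 G2) circ star.
Proof.
move=> [cc1 com1 as1 [cs1 ls1] acs1 lsc1] [cc2 com2 as2 [cs2 ls2] acs2 lsc2].
have gr1 := conf_graded cc1; have gr2 := conf_graded cc2.
have sc1 := conf_sesquilinear cc1; have sc2 := conf_sesquilinear cc2.
have ss1 := conf_sesquilinear cs1; have ss2 := conf_sesquilinear cs2.
have gc1 : graded_lprod G1 circ1 := conf_parity cc1.
have gc2 : graded_lprod G2 circ2 := conf_parity cc2.
have gs1 : graded_lprod G1 star1 := conf_parity cs1.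
have gs2 : graded_lprod G2 star2 := conf_parity cs2.
have [occ [Tcc Scc]] := is_tprod_exists gr1 gr2 sc1 sc2.
have [osc [Tsc Ssc]] := is_tprod_exists gr1 gr2 ss1 sc2.
have [ocs [Tcs Scs]] := is_tprod_exists gr1 gr2 sc1 ss2.
have Dcc := sesquilinear_biadd Scc; have Dsc := sesquilinear_biadd Ssc.
have Dcs := sesquilinear_biadd Scs.
have grT := tensor_Z2_graded gr1 gr2.
have Ass1 : assoc_pair circ1 circ1 by move=> a b c; rewrite as1.
have Ass2 : assoc_pair circ2 circ2 by move=> a b c; rewrite as2.
have Ycc1 := commutative_symm_pair sc1 com1.
have Ycs1 := commutative_symm_pair ss1 com1.
have Ycc2 := commutative_symm_pair sc2 com2.
have Ycs2 := commutative_symm_pair ss2 com2.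
have Ss := lprod_add_sesquilinear Ssc Scs.
have Ds := sesquilinear_biadd Ss.
(* [occ] is circ1 ⊗ circ2, while star is the sum of [osc] = star1 ⊗ circ2 and [ocs] = circ1 ⊗
   star2. *)
exists occ, (lprod_add osc ocs); split; [|split].
- have [Bc _ _] := Scc; split; first by split; [exact: Bc | exact: Tcc.2].
  move=> o [/bilinear_biadd oD oE]; apply: funext => u; apply: funext => v.
  apply: (tensor_biext_graded gr1 gr2 Dcc oD) => i j a1 a2 b1 b2 Ga Gb.
  by rewrite (Tcc.2 _ _ _ _ _ _ Ga Gb) (oE _ _ _ _ _ _ Ga Gb).
- have sE i j a1 a2 b1 b2 : G2 i a2 -> G1 j b1 ->
      lprod_add osc ocs (a1 ⊗ a2) (b1 ⊗ b2) =
      (-1) ^+ (i && j) *: (modpoly_tens (star1 a1 b1) (circ2 a2 b2) +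
                           modpoly_tens (circ1 a1 b1) (star2 a2 b2)).
    move=> Ga Gb; rewrite /lprod_add.
    by rewrite (Tsc.2 _ _ _ _ _ _ Ga Gb) (Tcs.2 _ _ _ _ _ _ Ga Gb) scalerDr.
  have [Bs _ _] := Ss; split; first by split; [exact: Bs | exact: sE].
  move=> o [/bilinear_biadd oD oE]; apply: funext => u; apply: funext => v.
  apply: (tensor_biext_graded gr1 gr2 Ds oD) => i j a1 a2 b1 b2 Ga Gb.
  by rewrite (sE _ _ _ _ _ _ Ga Gb) (oE _ _ _ _ _ _ Ga Gb).
split.
- exact: (conformalI grT Scc (tprod_graded gr1 Tcc gc1 gc2)).
- exact: (tprod_commutative Tcc com1 com2).
- by move=> u v w; rewrite (tprod_assoc_pair gr1 gr2 Tcc Tcc gc1 gc2 Ass1 Ass2).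
- split.
    apply: (conformalI grT Ss); apply: (lprod_add_graded grT).
      exact: (tprod_graded gr1 Tsc gs1 gc2).
    exact: (tprod_graded gr1 Tcs gc1 gs2).
  (* Four cases: when the outer left product is [osc], the first factor supplies left-symmetry
     (star1 with star1, or star1 with circ1); when it is [ocs], the second factor does. *)
  apply: (left_sym_addl Ds).
    apply: (left_sym_addr Dsc).
      exact: (tprod_left_sym1 gr1 gr2 Tsc Tsc gs1 gc2 ls1 Ass2 Ycc2).
    exact: (tprod_left_sym1 gr1 gr2 Tsc Tcs gc1 gc2 lsc1 acs2 Ycs2).
  apply: (left_sym_addr Dcs).
    exact: (tprod_left_sym2 gr1 gr2 Tcs Tsc gs1 gs2 lsc2 acs1 Ycs1).
  exact: (tprod_left_sym2 gr1 gr2 Tcs Tcs gc1 gs2 ls2 Ass1 Ycc1).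
- apply: (assoc_pair_addr Dcc).
    exact: (tprod_assoc_pair gr1 gr2 Tcc Tsc gs1 gc2 acs1 Ass2).
  exact: (tprod_assoc_pair gr1 gr2 Tcc Tcs gc1 gc2 Ass1 acs2).
(* In both cases the factor not carrying star contributes circ with circ, hence associativity and
   commutativity. *)
- apply: (left_sym_addl Dcc).
    exact: (tprod_left_sym1 gr1 gr2 Tsc Tcc gc1 gc2 lsc1 Ass2 Ycc2).
  exact: (tprod_left_sym2 gr1 gr2 Tcs Tcc gc1 gs2 lsc2 Ass1 Ycc1).
Qed.
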